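(* Let $P_1,P_2$ be finite bounded posets with $CL$-ceds $\{\Sigma_s^{(1)}\}$ and $\{\Sigma_t^{(2)}\}$ with respect to $CL$-labelings $\lambda_1,\lambda_2$ with disjoint label sets. Let $P$ be $P_1\times P_2$, $P_1\check{\times}P_2$ or $P_1\hat{\times}P_2$, with $\lambda$ the corresponding labeling $\lambda_1\times\lambda_2$, $\lambda_1\check{\times}\lambda_2$ (where $\lambda_1,\lambda_2$ are assumed orderly) or $\lambda_1\hat{\times}\lambda_2$ (where $\lambda_1,\lambda_2$ are assumed co-orderly). Let $\Sigma_{s,t}$ be the corresponding product ($\times$, $\check{\times}$ or $\hat{\times}$) of $\Sigma_s^{(1)}$ and $\Sigma_t^{(2)}$, ordered lexicographically by $(s,t)$. Then $\{\Sigma_{s,t}\}$ is a $CL$-ced of $P$ with respect to $\lambda$.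
   Context: Products: $P_1\times P_2$ componentwise; $P_1\check{\times}P_2=((P_1\setminus\{\hat0\})\times(P_2\setminus\{\hat0\}))\cup\{\hat0\}$; $P_1\hat{\times}P_2=((P_1\setminus\{\hat1\})\times(P_2\setminus\{\hat1\}))\cup\{\hat1\}$; $p_i$ coordinate projections. Rooted cover relation: $(\mathbf r,x\lessdot y)$ with $\mathbf r$ a maximal chain of $[\hat0,x]$; a $CL$-labeling labels rooted cover relations so that every rooted interval $[x,y]_{\mathbf r}$ has a unique maximal chain with weakly increasing labels, which is lexicographically first. A chain is descending if it has no position where a label is $\le$ the next. A $CL$-labeling is orderly if its label set is totally ordered and split as $S^-<S^A<S^+$ where all labels of edges $\hat0\lessdot x$ lie in $S^A$ and all other labels lie in $S^-\cup S^+$; co-orderly is the same with edges $x\lessdot\hat1$ in place of $\hat0\lessdot x$. Product labelings: label sets are shuffled as $S_1^-<S_2^-<S_1^A<S_2^A<S_1^+<S_2^+$ (any shuffle for $\times$). $\lambda_1\times\lambda_2$ labels a rooted edge by $\lambda_i(p_i(\mathbf r),p_i(x\lessdot y))$ where $i$ is the coordinate in which the edge projects to a cover relation. $\lambda_1\check{\times}\lambda_2$ labels $\hat0\lessdot y$ by the word $\lambda_1(\hat0\lessdot p_1(y))\lambda_2(\hat0\lessdot p_2(y))\in S_1^AS_2^A$ (ordered lexicographically, placed between $S_2^-$ and $S_1^+$) and other edges as in $\lambda_1\times\lambda_2$; $\lambda_1\hat{\times}\lambda_2$ labels $(\mathbf r,x\lessdot\hat1)$ by the word $\lambda_1(p_1(\mathbf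 r),p_1(x\lessdot\hat1))\lambda_2(p_2(\mathbf r),p_2(x\lessdot\hat1))$ and other edges as in $\lambda_1\times\lambda_2$. $CL$-ced of a rank-$k$ bounded poset $Q$ w.r.t. $CL$-labeling $\mu$: an ordered collection $\Sigma_1,\dots,\Sigma_m$ of rank-$k$ subposets, with $\Delta_s$ the simplicial complex generated by maximal chains in $\Sigma_s$ but in no $\Sigma_r$, $r<s$, such that: each $\Sigma_s$ is isomorphic to the face lattice of a convex polytope; for every $s$ and rooted interval $[x,y]_{\mathbf r}$ at most one descending maximal chain of $[x,y]_{\mathbf r}$ is a face of $\Delta_s$; any chain of length $<k$ extendable to maximal chains of both $\Delta_s$ and $\Delta_r$ ($r<s$) extends to a maximal chain of $\Sigma_s$ not in $\Delta_s$; every chain of $Q$ lies in some $\Sigma_s$. *)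

(* Defs.v *)
From HB Require Import structures.
From mathcomp Require Import all_boot all_order all_algebra.
From mathcomp Require Import boolp classical_sets reals.

Set Implicit Arguments.
Unset Strict Implicit.
Unset Printing Implicit Defensive.

Import Order.Theory GRing.Theory Num.Theory.

(* A finite poset is a finite set Q : {set T} with the order induced from the
   ambient poset type T, so that posets, their subposets and the three
   products below are all handled by the same definitions. *)
Section Posets.
Context {d : Order.disp_t} {T : finPOrderType d}.
Implicit Types (Q A c r : {set T}) (x y : T).

Definition chain c : bool := [forall x in c, forall y in c, (x >=< y)%O].

Definition chain_length c : nat := #|c|.-1.

Definition maxchain A c : bool :=
  maxset (fun B : {set T} => chain B && (B \subset A)) c.

Definition covers Q x y : bool :=
  [&& x \in Q, y \in Q, (x < y)%O & [forall z in Q, ~~ (x < z < y)%O]].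

Definition itv Q x y : {set T} := [set z in Q | (x <= z <= y)%O].

(* [0, x] when Q has a least element 0. *)
Definition below Q x : {set T} := [set z in Q | (z <= x)%O].

Definition bounded Q : Prop :=
  (exists2 b, b \in Q & {in Q, forall x, (b <= x)%O}) /\
  (exists2 t, t \in Q & {in Q, forall x, (x <= t)%O}).

Definition rk Q : nat :=
  \max_(c : {set T} | chain c && (c \subset Q)) chain_length c.

Definition graded Q : Prop := forall c, maxchain Q c -> chain_length c = rk Q.

End Posets.

Section LabelOrders.
Context {L : Type}.
Implicit Types (le : rel L) (s t : seq L).

Definition partial_order le : Prop :=
  [/\ reflexive le, antisymmetric le & transitive le].

(* For an antisymmetric le: strictly smaller at the first difference, or a
   prefix. *)
Fixpoint lexle le s t : bool :=
  match s, t with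
  | [::], _ => true
  | _ :: _, [::] => false
  | a :: s', b :: t' => le a b && (le b a ==> lexle le s' t')
  end.

Definition increasing le s : bool := sorted le s.

Definition descending le s : bool := sorted (fun a b => ~~ le a b) s.

End LabelOrders.

(* [lam r x y] is the label of the rooted cover relation (r, x <. y), where r
   is a maximal chain of [0, x]; other values of [lam] are never used. *)
Definition labeling {d : Order.disp_t} (T : finPOrderType d) (L : Type) : Type :=
  {set T} -> T -> T -> L.

Section CL.
Context {d : Order.disp_t} {T : finPOrderType d} {L : Type}.
Implicit Types (Q c r : {set T}) (x y : T) (le : rel L) (lam : labeling T L).

Fixpoint label_word lam r (s : seq T) : seq L :=
  match s with
  | x :: ((y :: _) as s') => lam r x y :: label_word lam (y |: r) s'
  | _ => [::]
  end.

Definition labels lam r c : seq L := label_word lam r (Order.enum c).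

Definition CL_labeling Q le lam : Prop :=
  partial_order le /\
  forall x y r, x \in Q -> y \in Q -> (x <= y)%O -> maxchain (below Q x) r ->
    exists c,
      [/\ maxchain (itv Q x y) c,
          increasing le (labels lam r c) &
          forall c', maxchain (itv Q x y) c' ->
            (increasing le (labels lam r c') -> c' = c) /\
            lexle le (labels lam r c) (labels lam r c')].

End CL.

Section Polytopes.
Local Open Scope ring_scope.
Context {R : realType}.

Definition conv {d n : nat} (v : 'I_n -> 'rV[R]_d) : set 'rV[R]_d :=
  [set x | exists w : 'I_n -> R,
     [/\ forall i, 0 <= w i, \sum_i w i = 1 & x = \sum_i w i *: v i]]%classic.

(* The faces cut out by valid inequalities; u = 0 gives the empty face and the
   whole polytope. *)
Definition is_face {d : nat} (K F : set 'rV[R]_d) : Prop :=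
  exists (u : 'cV[R]_d) (b : R),
    (forall x, K x -> (x *m u) 0 0 <= b) /\
    F = [set x | K x /\ (x *m u) 0 0 = b]%classic.

End Polytopes.

(* A is isomorphic to the poset of all faces of a polytope, ordered by
   inclusion.  The empty polytope (n = 0), whose only face is the empty set, is
   allowed: its face lattice is the one-element poset. *)
Definition polytope_face_lattice (R : realType) {d : Order.disp_t}
    {T : finPOrderType d} (A : {set T}) : Prop :=
  exists (e n : nat) (v : 'I_n -> 'rV[R]_e) (f : T -> set 'rV[R]_e),
    [/\ {in A, forall x, is_face (conv v) (f x)},
        forall F, is_face (conv v) F -> exists2 x, x \in A & f x = F &
        {in A &, forall x y, (x <= y)%O <-> subset (f x) (f y)}].

Section CLced.
Context {d dI : Order.disp_t} {T : finPOrderType d} {I : finOrderType dI}.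
Variables (Q : {set T}) (Sig : I -> {set T}).

(* The maximal chains (facets) of the complex Delta_s. *)
Definition new_chain (s : I) (c : {set T}) : bool :=
  maxchain (Sig s) c && [forall r : I, (r < s)%O ==> ~~ (c \subset Sig r)].

Definition delta_face (s : I) (c : {set T}) : Prop :=
  exists2 m, new_chain s m & c \subset m.

Record CLced (R : realType) (L : Type) (le : rel L) (lam : labeling T L) : Prop :=
  MkCLced {
    CLced_bounded : bounded Q;
    CLced_graded : graded Q;
    CLced_labeling : CL_labeling Q le lam;
    CLced_sub : forall s, Sig s \subset Q;
    CLced_rank : forall s, graded (Sig s) /\ rk (Sig s) = rk Q;
    CLced_polytope : forall s, polytope_face_lattice R (Sig s);
    CLced_desc : forall s x y r c c',
      x \in Q -> y \in Q -> (x <= y)%O -> maxchain (below Q x) r ->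
      maxchain (itv Q x y) c -> descending le (labels lam r c) ->
      delta_face s c ->
      maxchain (itv Q x y) c' -> descending le (labels lam r c') ->
      delta_face s c' ->
      c = c';
    CLced_bdry : forall s r c,
      (r < s)%O -> chain c -> chain_length c < rk Q ->
      delta_face s c -> delta_face r c ->
      exists m, [/\ maxchain (Sig s) m, ~~ new_chain s m & c \subset m];
    CLced_union : forall c, chain c -> c \subset Q -> exists s, c \subset Sig s
  }.

End CLced.

Section PosetProducts.
Context {d1 d2 : Order.disp_t} {T1 : finTBPOrderType d1} {T2 : finTBPOrderType d2}.

Definition prod_poset (A1 : {set T1}) (A2 : {set T2}) : {set T1 *p T2} :=
  [set z : T1 *p T2 | (z.1 \in A1) && (z.2 \in A2)].

Definition check_poset (A1 : {set T1}) (A2 : {set T2}) : {set T1 *p T2} :=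
  ((\bot, \bot)%O : T1 *p T2) |: prod_poset (A1 :\ \bot%O) (A2 :\ \bot%O).

Definition hat_poset (A1 : {set T1}) (A2 : {set T2}) : {set T1 *p T2} :=
  ((\top, \top)%O : T1 *p T2) |: prod_poset (A1 :\ \top%O) (A2 :\ \top%O).

End PosetProducts.

(* The parts S^-, S^A, S^+ of a label set. *)
Inductive part : Type := SNeg | SMid | SPos.

Definition part_rank (p : part) : nat :=
  match p with SNeg => 0 | SMid => 1 | SPos => 2 end.

Section Orderly.
Context {d : Order.disp_t} {T : finTBPOrderType d} {L : Type}.
Variables (le : rel L) (sg : L -> part) (lam : labeling T L).

Definition split_total_order : Prop :=
  [/\ partial_order le, total le &
      forall a b, part_rank (sg a) < part_rank (sg b) -> le a b].

Definition orderly : Prop :=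
  split_total_order /\
  forall r x y, covers [set: T] x y -> maxchain (below [set: T] x) r ->
    sg (lam r x y) = SMid <-> x = \bot%O.

Definition co_orderly : Prop :=
  split_total_order /\
  forall r x y, covers [set: T] x y -> maxchain (below [set: T] x) r ->
    sg (lam r x y) = SMid <-> y = \top%O.

End Orderly.

(* A shuffle of two partially ordered label sets: a partial order on their
   disjoint union that restricts to the given orders and compares any label of
   the first with any label of the second.  When le1 and le2 are total these
   are exactly the total orders on the union extending both. *)
Definition shuffle {L1 L2 : Type} (le1 : rel L1) (le2 : rel L2)
    (le : rel (L1 + L2)) : Prop :=
  [/\ partial_order le,
      forall a b, le (inl a) (inl b) = le1 a b,
      forall a b, le (inr a) (inr b) = le2 a b &
      forall a b, le (inl a) (inr b) || le (inr b) (inl a)].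

Inductive wlabel (L1 L2 : Type) : Type :=
  | Lab1 of L1
  | Lab2 of L2
  | Word of L1 & L2.

Section WordOrder.
Context {L1 L2 : Type}.
Variables (le1 : rel L1) (le2 : rel L2) (sg1 : L1 -> part) (sg2 : L2 -> part).

(* The blocks, in increasing order:
   S1^- < S2^- < S1^A < S2^A < words < S1^+ < S2^+. *)
Definition wblock (u : wlabel L1 L2) : nat :=
  match u with
  | Lab1 a => match sg1 a with SNeg => 0 | SMid => 2 | SPos => 5 end
  | Lab2 b => match sg2 b with SNeg => 1 | SMid => 3 | SPos => 6 end
  | Word _ _ => 4
  end.

Definition word_shuffle : rel (wlabel L1 L2) := fun u v =>
  (wblock u < wblock v) ||
  match u, v with
  | Lab1 a, Lab1 b => (wblock u == wblock v) && le1 a b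
  | Lab2 a, Lab2 b => (wblock u == wblock v) && le2 a b
  | Word a1 a2, Word b1 b2 => le1 a1 b1 && (le1 b1 a1 ==> le2 a2 b2)
  | _, _ => false
  end.

End WordOrder.

Section ProductLabelings.
Context {d1 d2 : Order.disp_t} {T1 : finTBPOrderType d1} {T2 : finTBPOrderType d2}.
Context {L1 L2 : Type}.
Variables (lam1 : labeling T1 L1) (lam2 : labeling T2 L2).

Definition proj1_chain (r : {set T1 *p T2}) : {set T1} := [set z.1 | z in r].
Definition proj2_chain (r : {set T1 *p T2}) : {set T2} := [set z.2 | z in r].

Definition prod_labeling : labeling (T1 *p T2) (L1 + L2) := fun r x y =>
  if covers [set: T1] x.1 y.1 then inl (lam1 (proj1_chain r) x.1 y.1)
  else inr (lam2 (proj2_chain r) x.2 y.2).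

Definition letter (u : L1 + L2) : wlabel L1 L2 :=
  match u with inl a => Lab1 L2 a | inr b => Lab2 L1 b end.

Definition word_labeling (is_word_edge : T1 *p T2 -> T1 *p T2 -> bool) :
    labeling (T1 *p T2) (wlabel L1 L2) := fun r x y =>
  if is_word_edge x y
  then Word (lam1 (proj1_chain r) x.1 y.1) (lam2 (proj2_chain r) x.2 y.2)
  else letter (prod_labeling r x y).

Definition check_labeling : labeling (T1 *p T2) (wlabel L1 L2) :=
  word_labeling (fun x _ => x == (\bot, \bot)%O).

Definition hat_labeling : labeling (T1 *p T2) (wlabel L1 L2) :=
  word_labeling (fun _ y => y == (\top, \top)%O).

End ProductLabelings.

(* Main.v *)
(** A maximal chain of an interval of the product projects to maximal chains of
    the two factors, and its label word is a merge of the two projected words,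
    with one pair of letters fused into a word for check and hat.  A merge is
    increasing (descending) iff both words are and the letters are merged in
    order; labels of different factors are comparable and distinct, so the merge
    is unique.  This reduces the CL-property and the uniqueness of descending
    chains to the factors.  New chains of the (s,t)-th product are those with
    both projections new, which gives the boundary condition.  The three products
    of face lattices are those of the free join, the cartesian product and the
    direct sum of the polytopes. *)
Require Import Defs.
From HB Require Import structures.
From mathcomp Require Import all_boot all_order all_algebra.

Set Implicit Arguments.
Unset Strict Implicit.
Unset Printing Implicit Defensive.

Import Order.Theory GRing.Theory Num.Theory.

(** Three difficulties shape the proof. For the plain product the factor orders may be partial, so
    the relation [~~ le] behind descending chains need not be transitive; labels of different
    factors are always comparable, though, and transitivity across factors is all that a merge uses.
    This is why merging is argued for a relation [rho], covering increasing and descending words at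
    once. A lexicographic comparison of two words says nothing about their second letters.
    Projecting is still safe, because a maximal chain has at most one word edge and a word compares
    with a letter outside S^A exactly as its own letter in that factor does, which is what
    orderliness provides. Lexicographic minimality does not pass through projections, as words may
    be merged in different orders. It is derived from a sharper local fact: the first label of the
    increasing chain is strictly below that of every other atom of the interval. A one-point factor
    collapses the check and hat products to a point and is treated apart. *)

Section ChainPaths.
Context {d : Order.disp_t} {T : finPOrderType d}.
Implicit Types (Q A c r : {set T}) (x y z : T) (p : seq T).

(** * Maximal chains of intervals as paths of cover relations *)

Lemma chainP c :
  reflect {in c &, forall x y, (x >=< y)%O} (chain c).
Proof.
apply: (iffP forall_inP) => [h x y xc yc|h x xc].
  by move/forall_inP: (h x xc); apply.
by apply/forall_inP => y yc; exact: h.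
Qed.

Lemma sub_chain c c' : c \subset c' -> chain c' -> chain c.
Proof.
move=> /subsetP s /chainP h; apply/chainP => x y xc yc.
by apply: h; apply: s.
Qed.

Lemma maxchainP A c :
  reflect [/\ chain c, c \subset A &
     forall z, z \in A -> {in c, forall w, (z >=< w)%O} -> z \in c]
   (maxchain A c).
Proof.
apply: (iffP (@maxsetP _ (fun B : {set T} => chain B && (B \subset A)) c)) => [[/andP[cc cA] m]|[cc cA m]]; split=> //.
- move=> z zA hz; suff <-: z |: c = c by rewrite setU11.
  apply: m; last exact: subsetU1.
  rewrite subUset sub1set zA cA /= andbT.
  apply/chainP => u v /setU1P[->|uc] /setU1P[->|vc].
  + exact: comparablexx.
  + exact: hz.
  + by rewrite comparable_sym; exact: hz.
  + by move/chainP: cc; apply.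
- by rewrite cc.
- move=> B /andP[cB BA] cB'; apply/eqP; rewrite eqEsubset cB' andbT.
  apply/subsetP => z zB; apply: m; first exact: (subsetP BA).
  by move=> w wc; move/chainP: cB; apply=> //; exact: (subsetP cB').
Qed.

Lemma coversP Q x y :
  reflect [/\ x \in Q, y \in Q, (x < y)%O &
     forall z, z \in Q -> (x < z)%O -> (z < y)%O -> False] (covers Q x y).
Proof.
apply: (iffP and4P) => [[xQ yQ xy /forall_inP h]|[xQ yQ xy h]]; split=> //.
  by move=> z zQ xz zy; move: (h z zQ); rewrite xz zy.
by apply/forall_inP => z zQ; apply/negP => /andP[]; exact: h.
Qed.

Lemma covers_lt Q x y : covers Q x y -> (x < y)%O.
Proof. by case/coversP. Qed.

Lemma path_covers_lt Q x p : path (covers Q) x p -> path <%O x p.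
Proof. by apply: sub_path => u v; exact: covers_lt. Qed.

Lemma path_covers_in Q x p : path (covers Q) x p -> {subset p <= Q}.
Proof.
elim: p x => [|y p IH] x //= /andP[/coversP[_ yQ _ _] /IH h] z.
by rewrite inE => /predU1P[->|/h].
Qed.

Lemma path_lt_all x p : path <%O x p -> {in p, forall z, (x < z)%O}.
Proof. by move=> /(order_path_min lt_trans)/allP. Qed.

Lemma path_lt_last x p : path <%O x p -> {in x :: p, forall z, (z <= last x p)%O}.
Proof.
elim: p x => [|y p IH] x /= => [_ z|/andP[xy yp] z].
  by rewrite inE => /eqP->.
rewrite inE => /predU1P[->|]; last exact: IH.
by rewrite (le_trans (ltW xy)) // IH // mem_head.
Qed.

Lemma path_lt_ge x p : path <%O x p -> {in x :: p, forall z, (x <= z)%O}.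
Proof.
move=> /path_lt_all h z; rewrite inE => /predU1P[->//|/h]; exact: ltW.
Qed.

Lemma chain_path x p : path <%O x p -> chain [set z in x :: p].
Proof.
move=> xp; apply/chainP => u v; rewrite !inE -!(in_cons x).
elim: p x xp => [|y p IH] x /= => [_|/andP[xy yp]].
  by rewrite !inE => /eqP-> /eqP->; rewrite comparablexx.
have h := path_lt_ge (_ : path <%O x (y :: p)); rewrite /= xy yp in h.
rewrite in_cons => /predU1P[->|uy] hv.
  by apply: le_comparable; exact: h.
move: hv; rewrite in_cons => /predU1P[->|vy]; last exact: (IH y).
by apply: ge_comparable; apply: h => //; rewrite in_cons uy orbT.
Qed.

Lemma enum_path x p : path <%O x p -> Order.enum [set z in x :: p] = x :: p.
Proof.
move=> xp; have xps : sorted <%O (x :: p) by [].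
have/chainP ch := chain_path xp.
have em : Order.enum [set z in x :: p] =i x :: p.
  by move=> z; rewrite mem_sort mem_enum inE.
apply: (@irr_sorted_eq _ <%O lt_trans ltxx) => //.
rewrite lt_sorted_uniq_le sort_uniq enum_uniq /=.
apply: (@sort_sorted_in _ (mem [set z in x :: p])) => //.
by apply/allP => z; rewrite mem_enum.
Qed.

(** Being comparable with the next vertex [y], [z] lies either in [[x, y]], where a cover leaves
    only the two ends, or above [y], where induction applies. *)
Lemma path_saturated Q x p z : path (covers Q) x p -> z \in Q ->
  (x <= z)%O -> (z <= last x p)%O -> {in x :: p, forall w, (z >=< w)%O} ->
  z \in x :: p.
Proof.
elim: p x => [|y p IH] x /= => [_ zQ xz zx _|/andP[xy yp] zQ xz zl h].
  by rewrite inE eq_le xz zx.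
have yin : y \in [:: x, y & p] by rewrite !inE eqxx orbT.
have/orP[zy|yz] := h y yin.
- move: zy; rewrite le_eqVlt => /predU1P[->|zy]; first by rewrite !inE eqxx orbT.
  move: xz; rewrite le_eqVlt => /predU1P[->|xz]; first by rewrite !inE eqxx.
  by case/coversP: xy => _ _ _ /(_ z zQ xz zy).
- rewrite in_cons IH ?orbT // => w wy; apply: h; by rewrite in_cons wy orbT.
Qed.

(** An element strictly between two consecutive vertices is comparable with the whole path, hence
    lies on it, which is absurd. *)
Lemma path_of_saturated Q x p : path <%O x p -> {subset x :: p <= Q} ->
  (forall z, z \in Q -> (x <= z)%O -> (z <= last x p)%O ->
     {in x :: p, forall w, (z >=< w)%O} -> z \in x :: p) ->
  path (covers Q) x p.
Proof.
elim: p x => [|y p IH] x //= /andP[xy yp] sQ sat.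
have yge := path_lt_ge yp; have ylast := path_lt_last yp.
have yQ : y \in Q by apply: sQ; rewrite !inE eqxx orbT.
apply/andP; split.
  apply/coversP; split=> //; first by apply: sQ; rewrite mem_head.
  move=> z zQ xz zy.
  have: z \in x :: y :: p.
    apply: sat => //; first exact: ltW.
      by rewrite (le_trans (ltW zy)) // ylast ?mem_head.
    move=> w; rewrite in_cons => /predU1P[->|/yge yw].
      by apply: ge_comparable; exact: ltW.
    by apply: le_comparable; rewrite (le_trans (ltW zy)).
  rewrite in_cons => /predU1P[zx|/yge yz]; first by rewrite zx ltxx in xz.
  by move: (lt_le_trans zy yz); rewrite ltxx.
apply: IH => //; first by move=> z zy; apply: sQ; rewrite in_cons zy orbT.
move=> z zQ yz zl h; have: z \in x :: y :: p.
  apply: sat => //; first by rewrite (le_trans (ltW xy)).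
  move=> w; rewrite in_cons => /predU1P[->|/h//].
  by apply: ge_comparable; rewrite (le_trans (ltW xy)).
rewrite in_cons => /predU1P[zx|//].
by move: (lt_le_trans xy yz); rewrite zx ltxx.
Qed.

(** The bridge from chains as sets to paths, on which all later inductions run. The start [x] is
    kept outside [p], so [size p] is the length of the chain. *)
Lemma maxchain_itvP Q x y c : x \in Q -> y \in Q -> (x <= y)%O ->
  reflect (exists p, [/\ path (covers Q) x p, last x p = y & c = [set z in x :: p]])
    (maxchain (itv Q x y) c).
Proof.
move=> xQ yQ xy; apply: (iffP (maxchainP _ _)) => [[/chainP cc cQ m]|].
- have ci z : z \in c -> [/\ z \in Q, (x <= z)%O & (z <= y)%O].
    by move/(subsetP cQ); rewrite inE => /andP[-> /andP[]].
  have xc : x \in c.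
    apply: m; first by rewrite inE xQ lexx xy.
    by move=> w /ci[_ ? _]; exact: le_comparable.
  have yc : y \in c.
    apply: m; first by rewrite inE yQ lexx xy.
    by move=> w /ci[_ _ ?]; exact: ge_comparable.
  have es : sorted <=%O (Order.enum c).
    apply: (@sort_sorted_in _ (mem c)) => //.
    by apply/allP => z; rewrite mem_enum.
  have eu : uniq (Order.enum c) by rewrite sort_uniq enum_uniq.
  have em z : (z \in Order.enum c) = (z \in c) by rewrite mem_sort mem_enum.
  have {es} es : sorted <%O (Order.enum c) by rewrite lt_sorted_uniq_le eu.
  case: (Order.enum c) es eu em => [|x' p] es eu em.
    by rewrite -em in xc.
  have ex : x' = x.
    apply/eqP; rewrite eq_le (path_lt_ge es) ?em //=.
    by case: (ci x') => //; rewrite -em mem_head.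
  rewrite {x'}ex in es eu em.
  have el : last x p = y.
    apply/eqP; rewrite eq_le (path_lt_last es) ?em // andbT.
    by case: (ci (last x p)) => //; rewrite -em mem_last.
  exists p; split=> //; last by apply/setP => z; rewrite [in RHS]inE em.
  apply: path_of_saturated => //; first by move=> z; rewrite em => /ci[].
  move=> z zQ xz; rewrite el => zy h; rewrite em; apply: m.
    by rewrite inE zQ xz zy.
  by move=> w wc; apply: h; rewrite em.
- move=> [p [xp el ->]]; have xp' := path_covers_lt xp; split.
  + exact: chain_path.
  + apply/subsetP => z; rewrite inE => zp.
    rewrite inE (path_lt_ge xp') // -el (path_lt_last xp') // !andbT.
    by move: zp; rewrite inE => /predU1P[->//|]; exact: (path_covers_in xp).
  + move=> z; rewrite inE => /andP[zQ /andP[xz zy]] h; rewrite inE.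
    apply: (path_saturated xp) => //; first by rewrite el.
    by move=> w wp; apply: h; rewrite inE.
Qed.

Lemma maxchain_itv_path Q x y c : x \in Q -> y \in Q -> (x <= y)%O ->
  maxchain (itv Q x y) c ->
  exists p, [/\ path (covers Q) x p, last x p = y & c = [set z in x :: p]].
Proof. by move=> xQ yQ xy /maxchain_itvP; apply. Qed.

Lemma maxchain_path Q x p : x \in Q -> path (covers Q) x p ->
  maxchain (itv Q x (last x p)) [set z in x :: p].
Proof.
move=> xQ xp; have xp' := path_covers_lt xp.
apply/maxchain_itvP => //; last by exists p.
- case: p xp {xp'} => // y p /path_covers_in h; apply: h => /=; exact: mem_last.
- by apply: (path_lt_last xp'); rewrite mem_head.
Qed.

Lemma set_path_inj x p p' : path <%O x p -> path <%O x p' ->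
  [set z in x :: p] = [set z in x :: p'] -> p = p'.
Proof.
by move=> /enum_path e /enum_path e' s; move: e; rewrite s e' => -[].
Qed.

Lemma card_path x p : path <%O x p -> #|[set z in x :: p]| = (size p).+1.
Proof.
move=> xp; rewrite cardsE; apply/card_uniqP.
exact: (@sorted_uniq _ <%O lt_trans ltxx (x :: p)).
Qed.

Lemma chain_length_path x p :
  path <%O x p -> chain_length [set z in x :: p] = size p.
Proof. by move=> xp; rewrite /chain_length card_path. Qed.

Lemma itv_full Q b t : {in Q, forall z, (b <= z <= t)%O} -> itv Q b t = Q.
Proof.
by move=> h; apply/setP => z; rewrite inE; case zQ: (z \in Q); rewrite //= h.
Qed.

Lemma below_itv Q b x : {in Q, forall z, (b <= z)%O} -> below Q x = itv Q b x.
Proof.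
by move=> h; apply/setP => z; rewrite !inE; case zQ: (z \in Q); rewrite //= h.
Qed.

Lemma maxchain_exists A c : chain c -> c \subset A ->
  exists2 m, maxchain A m & c \subset m.
Proof.
move=> cc cA.
have [m mm cm] := @maxset_exists _ (fun B : {set T} => chain B && (B \subset A)) c
  (introT andP (conj cc cA)).
by exists m.
Qed.

Lemma leq_chain_length c c' : c \subset c' -> chain_length c <= chain_length c'.
Proof. by move=> /subset_leq_card h; rewrite /chain_length -!subn1 leq_sub2r. Qed.

Lemma graded_rk A n : (forall c, maxchain A c -> chain_length c = n) ->
  graded A /\ rk A = n.
Proof.
move=> h; suff e : rk A = n by split=> // c /h ->.
apply/eqP; rewrite eqn_leq; apply/andP; split.
  apply/bigmax_leqP => c /andP[cc cA].
  by have [m /h <- cm] := maxchain_exists cc cA; exact: leq_chain_length.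
(* The empty chain extends to a maximal one, so the value [n] is attained. *)
have [||m mm _] := @maxchain_exists A set0.
- by apply/chainP => x y; rewrite inE.
- exact: sub0set.
- rewrite -(h m mm); apply: (@leq_bigmax_cond _ _ (@chain_length _ T) m).
  by case/maxchainP: mm => -> ->.
Qed.

End ChainPaths.

(** * Rooted labels along cover paths *)

Section CLPaths.
Context {d : Order.disp_t} {T : finPOrderType d} {L : Type}.
Variables (Q : {set T}) (le : rel L) (lam : labeling T L).
Implicit Types (x y z : T) (p : seq T) (r : {set T}).

Lemma label_word_cons r x y p :
  label_word lam r [:: x, y & p] = lam r x y :: label_word lam (y |: r) (y :: p).
Proof. by []. Qed.

Lemma labels_path r x p : path (covers Q) x p ->
  labels lam r [set z in x :: p] = label_word lam r (x :: p).
Proof. by move=> /path_covers_lt xp; rewrite /labels enum_path. Qed.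

Lemma root_step b r x y : b \in Q -> {in Q, forall z, (b <= z)%O} ->
  maxchain (below Q x) r -> covers Q x y -> maxchain (below Q y) (y |: r).
Proof.
move=> bQ hb; rewrite !(below_itv _ hb) => mr xy.
have [xQ yQ _ _] := coversP _ _ _ xy.
have bx := hb x xQ; have by' := hb y yQ.
have [p [bp lp ->]] := maxchain_itv_path bQ xQ bx mr.
have -> : y |: [set z in b :: p] = [set z in b :: rcons p y].
  by apply/setP => z; rewrite !inE mem_rcons inE orbCA.
apply/maxchain_itvP => //.
by exists (rcons p y); rewrite rcons_path last_rcons bp lp xy.
Qed.

(** With its converse [CL_of_paths], this moves the CL-property to paths, whose label words are
    computed by recursion on the path. *)
Lemma CL_pathE : CL_labeling Q le lam ->
  forall x y r, x \in Q -> y \in Q -> (x <= y)%O -> maxchain (below Q x) r ->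
  exists p, [/\ path (covers Q) x p, last x p = y,
    sorted le (label_word lam r (x :: p)) &
    forall p', path (covers Q) x p' -> last x p' = y ->
      (sorted le (label_word lam r (x :: p')) -> p' = p) /\
      lexle le (label_word lam r (x :: p)) (label_word lam r (x :: p'))].
Proof.
move=> [_ H] x y r xQ yQ xy mr; have [c [mc ic uc]] := H x y r xQ yQ xy mr.
have [p [xp lp cE]] := maxchain_itv_path xQ yQ xy mc.
move: ic uc; rewrite {}cE /increasing.
rewrite (labels_path _ xp) => ip up; exists p; split=> // p' xp' lp'.
have mp' : maxchain (itv Q x y) [set z in x :: p'] by rewrite -lp' maxchain_path.
have [] := up _ mp'; rewrite (labels_path _ xp') => h1 h2.
by split=> // /h1; exact: set_path_inj (path_covers_lt xp') (path_covers_lt xp).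
Qed.

Lemma CL_of_paths : partial_order le ->
  (forall x y r, x \in Q -> y \in Q -> (x <= y)%O -> maxchain (below Q x) r ->
  exists p, [/\ path (covers Q) x p, last x p = y,
    sorted le (label_word lam r (x :: p)) &
    forall p', path (covers Q) x p' -> last x p' = y ->
      (sorted le (label_word lam r (x :: p')) -> p' = p) /\
      lexle le (label_word lam r (x :: p)) (label_word lam r (x :: p'))]) ->
  CL_labeling Q le lam.
Proof.
move=> ple H; split=> // x y r xQ yQ xy mr.
have [p [xp lp ip up]] := H x y r xQ yQ xy mr.
exists [set z in x :: p]; rewrite /increasing (labels_path _ xp); split=> //.
  by rewrite -lp; exact: maxchain_path.
move=> c' /(maxchain_itv_path xQ yQ xy)[p' [xp' lp' ->]]; rewrite (labels_path _ xp').
by have [h1 h2] := up p' xp' lp'; split=> // /h1 ->.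
Qed.

(* A tie between the first label of the increasing chain and that of another
   atom z would let the increasing chain above z extend to a second one. *)
Lemma CL_first b r x a q z : b \in Q -> {in Q, forall z, (b <= z)%O} ->
  CL_labeling Q le lam -> maxchain (below Q x) r ->
  path (covers Q) x (a :: q) -> sorted le (label_word lam r [:: x, a & q]) ->
  covers Q x z -> (z <= last a q)%O -> z != a ->
  le (lam r x a) (lam r x z) && ~~ le (lam r x z) (lam r x a).
Proof.
move=> bQ hb CL mr xp ip xz zl za.
have [xQ zQ ltxz _] := coversP _ _ _ xz.
have aqQ : {subset a :: q <= Q} by exact: path_covers_in xp.
have yQ : last a q \in Q by apply: aqQ; exact: mem_last.
have xy : (x <= last a q)%O by rewrite (le_trans (ltW ltxz)).
have [p [_ _ _ up]] := CL_pathE CL xQ yQ xy mr.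
have [/(_ ip) ep _] := up (a :: q) xp erefl; rewrite -{p}ep in up.
have [p [zp lp iz _]] := CL_pathE CL zQ yQ zl (root_step bQ hb mr xz).
have xzp : path (covers Q) x (z :: p) by rewrite /= xz zp.
have [uzp] := up (z :: p) xzp lp.
rewrite !label_word_cons [lexle _ _ _]/= => /andP[lel /implyP lex].
rewrite lel; apply/negP => lel'; have {}lex := lex lel'.
have [_ _ tr] := CL.1.
suff /uzp[] : sorted le (label_word lam r [:: x, z & p]) by move/eqP: za.
rewrite label_word_cons; case: {uzp xzp zp} p lp iz lex => [//|z' p] lp iz lex.
rewrite /= in iz lex *; rewrite iz andbT.
case: q ip lex xy zl up lp xp aqQ yQ => [|a' q] ip lex xy zl _ lp xp _ _.
  have /coversP[_ _ _ /(_ z zQ ltxz)] : covers Q x a by case/andP: xp.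
  by case; rewrite lt_neqAle za zl.
case/andP: lex => lex _; case/andP: ip => ip _.
exact: tr (tr _ _ _ lel' ip) lex.
Qed.

End CLPaths.

(** * Images of cover paths under a projection *)

Section Projections.
Context {d d' : Order.disp_t} {T : finPOrderType d} {T' : finPOrderType d'}.
Variables (Q : {set T}) (A : {set T'}) (f : T -> T').
Hypothesis covers_f : forall x y, covers Q x y -> f x = f y \/ covers A (f x) (f y).
Implicit Types (x y : T) (p : seq T).

(** Stationary steps are deleted, so the image is again a path of covers rather than a weakly
    increasing sequence. *)
Fixpoint proj_path x p : seq T' :=
  if p is y :: q then
    if f x == f y then proj_path y q else f y :: proj_path y q
  else [::].

Lemma last_proj_path x p : last (f x) (proj_path x p) = f (last x p).
Proof. by elim: p x => //= y p IH x; case: eqP => [->|_] /=; exact: IH. Qed.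

Lemma mem_proj_path x p : f x :: proj_path x p =i map f (x :: p).
Proof.
elim: p x => //= y p IH x z.
case: eqP => [->|_]; last by rewrite in_cons IH /= !inE.
by rewrite IH /= !inE orbA orbb.
Qed.

Lemma proj_pathP x p : path (covers Q) x p -> path (covers A) (f x) (proj_path x p).
Proof.
elim: p x => //= y p IH x /andP[/covers_f xy /IH yp].
case: eqP => [->//|fxy] /=; rewrite yp andbT.
by case: xy.
Qed.

Lemma imset_proj_path x p :
  [set f z | z in [set z in x :: p]] = [set z in f x :: proj_path x p].
Proof.
apply/setP => z; rewrite [RHS]inE mem_proj_path.
by apply/imsetP/mapP => -[w wp ->]; exists w => //; move: wp; rewrite inE.
Qed.

Lemma maxchain_proj x y c : x \in Q -> y \in Q -> (x <= y)%O -> f x \in A ->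
  maxchain (itv Q x y) c -> maxchain (itv A (f x) (f y)) [set f z | z in c].
Proof.
move=> xQ yQ xy fx /(maxchain_itv_path xQ yQ xy)[p [xp <- ->]].
rewrite imset_proj_path -last_proj_path.
by apply: maxchain_path => //; exact: proj_pathP.
Qed.

End Projections.

(* PX, PC, PH stand for the products x, check, hat; [good k] singles out the
   elements of the product among all pairs, and [wedge k] its edges labelled by
   words. *)
Inductive pkind : Type := PX | PC | PH.

(** * The three products as one family of subsets of the pairs, and their cover relations *)

Section Products.
Context {d1 d2 : Order.disp_t} {T1 : finTBPOrderType d1} {T2 : finTBPOrderType d2}.
Notation T := (T1 *p T2).
Implicit Types (k : pkind) (x y z : T) (p : seq T).

Definition good k z : bool :=
  match k with
  | PX => true
  | PC => (z.1 == \bot%O) == (z.2 == \bot%O)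
  | PH => (z.1 == \top%O) == (z.2 == \top%O)
  end.

(** Removing and regluing a bottom (top) amounts to letting the two coordinates reach it only
    together. This agrees with the check (hat) product when both sets contain their bottom (top). *)
Definition pp k (A1 : {set T1}) (A2 : {set T2}) : {set T} := [set z : T | [&& z.1 \in A1, z.2 \in A2 & good k z]].

Definition wedge k x y : bool :=
  match k with PX => false | PC => x.1 == \bot%O | PH => y.1 == \top%O end.

(** If just one factor is a point, one of the pairs [(bot, bot)], [(top, top)] fails to be good for
    check or hat. The condition keeps both ends in [pp]. *)
Definition nontrivial_factors k : bool :=
  if k is PX then true else (\bot%O != \top%O :> T1) && (\bot%O != \top%O :> T2).

Lemma eq_botF {d} {P : finTBPOrderType d} (a b : P) : (a < b)%O -> (b == \bot%O) = false.
Proof. by move=> ab; apply/negP => /eqP e; move: ab; rewrite e ltx0. Qed.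

Lemma eq_topF {d} {P : finTBPOrderType d} (a b : P) : (a < b)%O -> (a == \top%O) = false.
Proof. by move=> ab; apply/negP => /eqP e; move: ab; rewrite e lt1x. Qed.

Lemma prod_eqP x y : x.1 = y.1 -> x.2 = y.2 -> x = y.
Proof. by case: x y => [x1 x2] [y1 y2] /= -> ->. Qed.

Lemma in_pp k A1 A2 z : (z \in pp k A1 A2) = [&& z.1 \in A1, z.2 \in A2 & good k z].
Proof. by rewrite inE. Qed.

Variant pstep k A1 A2 x y : Prop :=
  | Step1 of covers A1 x.1 y.1 & x.2 = y.2
  | Step2 of x.1 = y.1 & covers A2 x.2 y.2
  | Step12 of wedge k x y & covers A1 x.1 y.1 & covers A2 x.2 y.2.

Lemma covers_pp_step k A1 A2 x y : covers (pp k A1 A2) x y -> pstep k A1 A2 x y.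
Proof.
move/coversP => []; rewrite !in_pp => /and3P[x1A x2A gx] /and3P[y1A y2A gy].
rewrite lt_neqAle leEprod => /and3P[nxy le1 le2] H.
(* The cover condition in a form to be tested on pairs that mix coordinates of [x], [y] and a
   candidate. *)
have hm (z : T) : z.1 \in A1 -> z.2 \in A2 -> good k z ->
    (x.1 <= z.1 <= y.1)%O -> (x.2 <= z.2 <= y.2)%O -> z = x \/ z = y.
  move=> z1 z2 gz /andP[l1 u1] /andP[l2 u2].
  have [->|nx] := eqVneq z x; first by left.
  have [->|ny] := eqVneq z y; first by right.
  case: (H z); rewrite ?in_pp ?z1 ?z2 //.
  - by rewrite lt_neqAle leEprod l1 l2 eq_sym nx.
  - by rewrite lt_neqAle leEprod u1 u2 ny.
have [e1|n1] := eqVneq x.1 y.1.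
  have [e2|n2] := eqVneq x.2 y.2.
    by case/eqP: nxy; exact: prod_eqP.
  have lt2 : (x.2 < y.2)%O by rewrite lt_neqAle n2 le2.
  apply: Step2 => //; apply/coversP; split=> // z zA xz zy.
  have [|||||/(congr1 snd)|/(congr1 snd)] /= := hm (x.1, z); rewrite //= ?lexx ?e1 ?lexx ?(ltW xz) ?(ltW zy) //.
  + move: gx gy; rewrite /good /= e1.
    by case: (k) => //; rewrite ?(eq_botF xz) ?(eq_botF lt2) ?(eq_topF zy) ?(eq_topF lt2) // => /eqP->.
  + by move=> e; rewrite e ltxx in xz.
  + by move=> e; rewrite e ltxx in zy.
have lt1 : (x.1 < y.1)%O by rewrite lt_neqAle n1 le1.
have [e2|n2] := eqVneq x.2 y.2.
  apply: Step1 => //; apply/coversP; split=> // z zA xz zy.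
  have [|||||/(congr1 fst)|/(congr1 fst)] /= := hm (z, x.2); rewrite //= ?lexx ?e2 ?lexx ?(ltW xz) ?(ltW zy) //.
  + move: gx gy; rewrite /good /= e2.
    by case: (k) => //; rewrite ?(eq_botF xz) ?(eq_botF lt1) ?(eq_topF zy) ?(eq_topF lt1) // => /eqP->.
  + by move=> e; rewrite e ltxx in xz.
  + by move=> e; rewrite e ltxx in zy.
have lt2 : (x.2 < y.2)%O by rewrite lt_neqAle n2 le2.
have [w|nw] := boolP (wedge k x y); last first.
  (* Away from word edges the corner [(y.1, x.2)] is good and lies strictly between, so both
     coordinates cannot move. *)
  have [|||||/(congr1 fst)|/(congr1 snd)] /= := hm (y.1, x.2); rewrite //= ?lexx ?le1 ?le2 //.
  + move: gx gy nw; rewrite /good /wedge /=.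
    case: (k) => //; rewrite ?(eq_botF lt1) ?(eq_botF lt2) ?(eq_topF lt1) ?(eq_topF lt2) //=.
    * by move=> /eqP<- _ /negbTE->.
    * by move=> _ _ /negbTE->.
  + by move=> e; rewrite e eqxx in n1.
  + by move=> e; rewrite e eqxx in n2.
(* On a word edge the test pair must be good: its other coordinate is taken from [y] for check, to
   avoid the bottom, and from [x] for hat, to avoid the top. *)
apply: Step12 => //; apply/coversP; split=> // z zA xz zy; case: (k) hm w gx gy => //= hm w.
- have [|||||/(congr1 fst)|/(congr1 fst)] /= := hm (z, y.2); rewrite //= ?lexx ?le1 ?le2 ?(ltW xz) ?(ltW zy) //.
  + by rewrite (eq_botF xz) (eq_botF lt2).
  + by move=> e; rewrite e ltxx in xz.
  + by move=> e; rewrite e ltxx in zy.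
- have [|||||/(congr1 fst)|/(congr1 fst)] /= := hm (z, x.2); rewrite //= ?lexx ?le1 ?le2 ?(ltW xz) ?(ltW zy) //.
  + by rewrite (eq_topF zy) (eq_topF lt2).
  + by move=> e; rewrite e ltxx in xz.
  + by move=> e; rewrite e ltxx in zy.
- have [|||||/(congr1 snd)|/(congr1 snd)] /= := hm (y.1, z); rewrite //= ?lexx ?le1 ?le2 ?(ltW xz) ?(ltW zy) //.
  + by rewrite (eq_botF xz) (eq_botF lt1).
  + by move=> e; rewrite e ltxx in xz.
  + by move=> e; rewrite e ltxx in zy.
- have [|||||/(congr1 snd)|/(congr1 snd)] /= := hm (x.1, z); rewrite //= ?lexx ?le1 ?le2 ?(ltW xz) ?(ltW zy) //.
  + by rewrite (eq_topF zy) (eq_topF lt1).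
  + by move=> e; rewrite e ltxx in xz.
  + by move=> e; rewrite e ltxx in zy.
Qed.

Lemma step1_good k x y : good k x -> good k y -> (x.1 < y.1)%O -> x.2 = y.2 ->
  ~~ wedge k x y.
Proof.
move=> + + lt e; rewrite /good /wedge e; case: k => // /eqP ex /eqP ey.
- by rewrite ex -ey (eq_botF lt).
- by rewrite ey -ex (eq_topF lt).
Qed.

Lemma step2_good k x y : good k x -> good k y -> x.1 = y.1 -> (x.2 < y.2)%O ->
  ~~ wedge k x y.
Proof.
move=> + + e lt; rewrite /good /wedge e; case: k => // /eqP ex /eqP ey.
- by rewrite ey (eq_botF lt).
- by rewrite ex (eq_topF lt).
Qed.

Lemma wedge_bot_top k x y : good k x -> good k y -> wedge k x y ->
  match k with
  | PX => False
  | PC => x = ((\bot, \bot)%O : T)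
  | PH => y = ((\top, \top)%O : T)
  end.
Proof.
rewrite /good /wedge; case: k => // + + /eqP e; rewrite e eqxx => gx gy.
- by apply: prod_eqP => //=; apply/eqP; rewrite -(eqP gx).
- by apply: prod_eqP => //=; apply/eqP; rewrite -(eqP gy).
Qed.

Lemma step_covers k A1 A2 x y : x \in pp k A1 A2 -> y \in pp k A1 A2 ->
  pstep k A1 A2 x y -> covers (pp k A1 A2) x y.
Proof.
move=> xP yP; have := xP; have := yP; rewrite !in_pp.
move=> /and3P[y1 y2 gy] /and3P[x1 x2 gx] st.
have lexy : (x <= y)%O.
  by rewrite leEprod; case: st => [/covers_lt/ltW-> ->|-> /covers_lt/ltW->|_ /covers_lt/ltW-> /covers_lt/ltW->]; rewrite ?lexx.
have nxy : x != y.
  apply/eqP => e; rewrite e in st; case: st => [/covers_lt|_ /covers_lt|_ /covers_lt];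
  by rewrite ltxx.
apply/coversP; split=> //; first by rewrite lt_neqAle nxy.
move=> z; rewrite in_pp => /and3P[z1 z2 gz].
rewrite !lt_neqAle !leEprod => /and3P[nxz lxz1 lxz2] /and3P[nzy lzy1 lzy2].
have mid1 : covers A1 x.1 y.1 -> z.1 = x.1 \/ z.1 = y.1.
  case/coversP=> _ _ _ /(_ z.1 z1); have [<-|n1] := eqVneq x.1 z.1; first by left.
  have [->|n2] := eqVneq z.1 y.1; first by right.
  by rewrite !lt_neqAle n1 n2 lxz1 lzy1 => /(_ isT isT).
have mid2 : covers A2 x.2 y.2 -> z.2 = x.2 \/ z.2 = y.2.
  case/coversP=> _ _ _ /(_ z.2 z2); have [<-|n1] := eqVneq x.2 z.2; first by left.
  have [->|n2] := eqVneq z.2 y.2; first by right.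
  by rewrite !lt_neqAle n1 n2 lxz2 lzy2 => /(_ isT isT).
case: st => [/mid1 e1 e2|e1 /mid2 e2|w c1 c2].
- have e : z.2 = y.2 by apply/le_anti; rewrite lzy2 -e2 lxz2.
  case: e1 => e1; first by case/eqP: nxz; apply: prod_eqP => //; rewrite e2.
  by case/eqP: nzy; exact: prod_eqP.
- have e : z.1 = y.1 by apply/le_anti; rewrite lzy1 -e1 lxz1.
  case: e2 => e2; first by case/eqP: nxz; apply: prod_eqP => //; rewrite e1.
  by case/eqP: nzy; exact: prod_eqP.
(* The only candidates are the four corners of the rectangle. A mixed corner has exactly one
   coordinate at the bottom (top), so it is not good. *)
- have := wedge_bot_top gx gy w; case: (k) gz => //= /eqP gz e.
  + case: (mid1 c1) => e1; case: (mid2 c2) => e2.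
    * by case/eqP: nxz; apply: prod_eqP.
    * move: gz; rewrite e1 e2 e /= eqxx => /esym/eqP b.
      by move: (covers_lt c2); rewrite b ltx0.
    * move: gz; rewrite e1 e2 e /= eqxx => /eqP b.
      by move: (covers_lt c1); rewrite b ltx0.
    * by case/eqP: nzy; apply: prod_eqP.
  + case: (mid1 c1) => e1; case: (mid2 c2) => e2.
    * by case/eqP: nxz; apply: prod_eqP.
    * move: gz; rewrite e1 e2 e /= eqxx => /eqP b.
      by move: (covers_lt c1); rewrite b lt1x.
    * move: gz; rewrite e1 e2 e /= eqxx => /esym/eqP b.
      by move: (covers_lt c2); rewrite b lt1x.
    * by case/eqP: nzy; apply: prod_eqP.
Qed.

Lemma covers_pp_proj1 k A1 A2 x y : covers (pp k A1 A2) x y ->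
  x.1 = y.1 \/ covers A1 x.1 y.1.
Proof. by case/covers_pp_step; [right|left|right]. Qed.

Lemma covers_pp_proj2 k A1 A2 x y : covers (pp k A1 A2) x y ->
  x.2 = y.2 \/ covers A2 x.2 y.2.
Proof. by case/covers_pp_step; [left|right|right]. Qed.

Lemma covers_good k A1 A2 x y : covers (pp k A1 A2) x y -> good k x /\ good k y.
Proof. by case/coversP; rewrite !in_pp => /and3P[_ _ ->] /and3P[_ _ ->]. Qed.

(** For check the lower end alone decides whether an edge carries a word. For hat a word edge ends
    at the top, and then its lower end has no other upper cover. *)
Lemma covers_wedge k A1 A2 x y z : covers (pp k A1 A2) x y -> wedge k x y ->
  covers (pp k A1 A2) x z -> wedge k x z.
Proof.
move=> xy w xz; have [gx gy] := covers_good xy; have [_ gz] := covers_good xz.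
have := wedge_bot_top gx gy w; case: (k) w xy xz => //= w xy xz ey.
have [<-|nzy] := eqVneq y z; first by [].
have [_ zP ltxz _] := coversP _ _ _ xz.
have [_ _ _ /(_ z zP ltxz)] := coversP _ _ _ xy.
by case; rewrite lt_neqAle eq_sym nzy ey leEprod !lex1.
Qed.

(* The number of word edges on a maximal chain from x to y. *)
Definition n12 k x y : nat :=
  match k with
  | PX => 0
  | PC => (x.1 == \bot%O) && (y.1 != \bot%O)
  | PH => (y.1 == \top%O) && (x.1 != \top%O)
  end.

Notation proj1 := (proj_path (fun z : T => z.1 : T1)).
Notation proj2 := (proj_path (fun z : T => z.2 : T2)).

(** An ordinary edge survives in one projection, a word edge in both. *)
Lemma size_proj k A1 A2 x p : path (covers (pp k A1 A2)) x p ->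
  size (proj1 x p) + size (proj2 x p) = size p + n12 k x (last x p).
Proof.
elim: p x => [|z p IH] x /=.
  by case: k => //=; case: (_ == _).
move=> /andP[xz zp]; have := IH z zp; have [gx gz] := covers_good xz.
have /path_lt_last/(_ z (mem_head _ _)) := path_covers_lt zp.
rewrite leEprod => /andP[le1 _].
case: (covers_pp_step xz) => [c1 e2|e1 c2|w c1 c2].
- have nw := step1_good gx gz (covers_lt c1) e2.
  rewrite e2 eqxx (lt_eqF (covers_lt c1)) /= addSn addSn => ->; congr (_ + _).+1.
  move: nw le1; rewrite /n12 /wedge; case: (k) => //=.
  + by move=> /negbTE->; rewrite (eq_botF (covers_lt c1)).
  + by move=> /negbTE->; rewrite (eq_topF (covers_lt c1)).
- have nw := step2_good gx gz e1 (covers_lt c2).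
  rewrite e1 eqxx (lt_eqF (covers_lt c2)) /= addnS addSn => ->; congr (_ + _).+1.
  by rewrite /n12 e1.
- rewrite (lt_eqF (covers_lt c1)) (lt_eqF (covers_lt c2)) /= !addSn addnS => ->.
  move: le1 w; rewrite /n12 /wedge; case: (k) => //= le1 /eqP e.
  + have zl := lt_le_trans (covers_lt c1) le1.
    by rewrite e eqxx (eq_botF (covers_lt c1)) (eq_botF zl) addn0 addn1.
  + rewrite e le1x in le1; rewrite le1 e eqxx (eq_topF (covers_lt c1)).
    by rewrite addn0 addn1.
Qed.

(** * Ends, projected maximal chains and rank of the products *)

Section Bounded.
Variables (k : pkind) (A1 : {set T1}) (A2 : {set T2}).
Hypotheses (b1 : \bot%O \in A1) (t1 : \top%O \in A1).
Hypotheses (b2 : \bot%O \in A2) (t2 : \top%O \in A2).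
Hypothesis nd : nontrivial_factors k.

Notation bot := ((\bot, \bot)%O : T).
Notation top := ((\top, \top)%O : T).

Lemma bot_in_pp : bot \in pp k A1 A2.
Proof.
rewrite in_pp b1 b2 /=; move: nd; case: k => //=; rewrite ?eqxx //.
by case/andP => /negbTE-> /negbTE->.
Qed.

Lemma top_in_pp : top \in pp k A1 A2.
Proof.
rewrite in_pp t1 t2 /=; move: nd; case: k => //=; rewrite ?eqxx //.
by case/andP; rewrite eq_sym => /negbTE->; rewrite eq_sym => /negbTE->.
Qed.

Lemma bot_le z : (bot <= z)%O. Proof. by rewrite leEprod !le0x. Qed.
Lemma le_top z : (z <= top)%O. Proof. by rewrite leEprod !lex1. Qed.

Lemma below_pp x : below (pp k A1 A2) x = itv (pp k A1 A2) bot x.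
Proof. by apply: below_itv => z _; exact: bot_le. Qed.

Lemma pp_itv : itv (pp k A1 A2) bot top = pp k A1 A2.
Proof. by apply: itv_full => z _; rewrite bot_le le_top. Qed.

Lemma maxchain_pp_proj1 m : maxchain (pp k A1 A2) m -> maxchain A1 (proj1_chain m).
Proof.
rewrite -pp_itv => /(maxchain_proj (@covers_pp_proj1 k A1 A2) bot_in_pp top_in_pp (bot_le _)).
by rewrite itv_full; first apply; rewrite //= => z _; rewrite le0x lex1.
Qed.

Lemma maxchain_pp_proj2 m : maxchain (pp k A1 A2) m -> maxchain A2 (proj2_chain m).
Proof.
rewrite -pp_itv => /(maxchain_proj (@covers_pp_proj2 k A1 A2) bot_in_pp top_in_pp (bot_le _)).
by rewrite itv_full; first apply; rewrite //= => z _; rewrite le0x lex1.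
Qed.

(** The number of word edges depends only on the endpoints, so the lengths of the two projections
    determine that of the chain. *)
Lemma graded_pp : graded A1 -> graded A2 ->
  graded (pp k A1 A2) /\ rk (pp k A1 A2) = rk A1 + rk A2 - n12 k bot top.
Proof.
move=> g1 g2; apply: graded_rk => c mc.
have m1 := g1 _ (maxchain_pp_proj1 mc); have m2 := g2 _ (maxchain_pp_proj2 mc).
rewrite -pp_itv in mc.
have [p [bp lp cE]] := maxchain_itv_path bot_in_pp top_in_pp (bot_le _) mc.
have e1 : proj1_chain c = [set z in \bot%O :: proj1 bot p].
  by rewrite cE; exact: (imset_proj_path (fun z : T => z.1 : T1) bot p).
have e2 : proj2_chain c = [set z in \bot%O :: proj2 bot p].
  by rewrite cE; exact: (imset_proj_path (fun z : T => z.2 : T2) bot p).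
rewrite -m1 -m2 e1 e2 cE.
rewrite !chain_length_path ?(path_covers_lt bp) //.
- by rewrite (size_proj bp) lp addnK.
- exact: path_covers_lt (proj_pathP (@covers_pp_proj2 k A1 A2) bp).
- exact: path_covers_lt (proj_pathP (@covers_pp_proj1 k A1 A2) bp).
Qed.

End Bounded.

End Products.

(** * Words in merged labels and their two projections *)

Section LabelWords.
Context {L1 L2 : Type}.
Notation W := (wlabel L1 L2).
Implicit Types (u v : W) (w : seq W).

(** Labels of different sides are the ones sure to be comparable; inside a side the order may be
    partial. *)
Definition side u : nat :=
  match u with Lab1 _ => 0 | Lab2 _ => 1 | Word _ _ => 2 end.

Definition letter1 u : option L1 :=
  match u with Lab1 a => Some a | Lab2 _ => None | Word a _ => Some a end.

Definition letter2 u : option L2 :=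
  match u with Lab1 _ => None | Lab2 b => Some b | Word _ b => Some b end.

Definition is_word u : bool := if u is Word _ _ then true else false.

Variables (md1 : pred L1) (md2 : pred L2).

(** [md1] and [md2] single out the labels of S^A, which may occur only inside words. Taking both to
    be [pred0] excludes words, as the plain product requires. *)
Definition valid u : bool :=
  match u with
  | Lab1 a => ~~ md1 a
  | Lab2 b => ~~ md2 b
  | Word a b => md1 a && md2 b
  end.

(* What the weakly increasing relation le and the descending relation ~~ le
   have in common; transitivity of the latter needs comparable labels. *)
Definition cross_transitive (rho : rel W) : Prop :=
  forall u v t, (side u != side v) || (side v != side t) ->
    rho u v -> rho v t -> rho u t.

Definition cross_asymmetric (rho : rel W) : Prop :=
  forall a b, rho (Lab1 L2 a) (Lab2 L1 b) -> rho (Lab2 L1 b) (Lab1 L2 a) -> False.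

(** A label without a letter in the chosen factor is bypassed by cross-transitivity, as it has
    another side than its neighbour that does have one. Two words are never compared, since only one
    may occur. *)
Lemma path_letters (L : Type) (f : W -> option L) (rho : rel W) (rho' : rel L) u a w :
  cross_transitive rho ->
  (forall u v, f u = None -> f v -> side u != side v) ->
  (forall u v a b, valid u -> valid v -> ~~ (is_word u && is_word v) ->
     f u = Some a -> f v = Some b -> rho u v -> rho' a b) ->
  f u = Some a -> all valid (u :: w) -> count is_word (u :: w) <= 1 ->
  path rho u w -> path rho' a (pmap f w).
Proof.
move=> tr sd pr; elim: w u a => [|v w IH] u a // fu /= /and3P[vu vv vw] cw /andP[uv vp].
case fv: (f v) => [b|] /=.
  apply/andP; split.
    apply: pr fu fv uv => //; move: cw; by case: (is_word u); case: (is_word v).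
  apply: IH fv _ _ vp; first by rewrite /= vv.
  by apply: leq_trans cw; rewrite leq_addl.
apply: (IH u) => //=; first by rewrite vu.
- by apply: leq_trans cw; rewrite leq_add2l leq_addl.
- case: w {IH vw cw} vp => //= t w /andP[vt ->]; rewrite andbT.
  by apply: tr uv vt; rewrite eq_sym sd // fu.
Qed.

Lemma sorted_letters (L : Type) (f : W -> option L) (rho : rel W) (rho' : rel L) w :
  cross_transitive rho ->
  (forall u v, f u = None -> f v -> side u != side v) ->
  (forall u v a b, valid u -> valid v -> ~~ (is_word u && is_word v) ->
     f u = Some a -> f v = Some b -> rho u v -> rho' a b) ->
  all valid w -> count is_word w <= 1 ->
  sorted rho w -> sorted rho' (pmap f w).
Proof.
move=> tr sd pr; elim: w => [|u w IH] // av cw sw.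
rewrite /=; case fu: (f u) => [a|] /=; first exact: path_letters sw.
apply: IH; first by case/andP: av.
- by apply: leq_trans cw; rewrite /= leq_addl.
- exact: path_sorted sw.
Qed.

(** Up to the first letter of the second factor only single letters of the first occur, and
    [~~ md2 b] keeps that letter out of a word. Transitivity then carries [a] to [b]. *)
Lemma cross_letter1 (rho : rel W) a b t w : cross_transitive rho ->
  all valid w -> path rho (Lab1 L2 a) w -> pmap letter2 w = b :: t -> ~~ md2 b ->
  rho (Lab1 L2 a) (Lab2 L1 b).
Proof.
move=> tr; elim: w a => [|[c|c|c c'] w IH] a //= /andP[vc vw] /andP[ac cp].
- by move=> ew mb; apply: tr ac _ => //; exact: IH vw cp ew mb.
- by case=> <-.
- by case=> <- _; case/andP: vc => _ ->.
Qed.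

Lemma cross_letter2 (rho : rel W) b a t w : cross_transitive rho ->
  all valid w -> path rho (Lab2 L1 b) w -> pmap letter1 w = a :: t -> ~~ md1 a ->
  rho (Lab2 L1 b) (Lab1 L2 a).
Proof.
move=> tr; elim: w b => [|[c|c|c c'] w IH] b //= /andP[vc vw] /andP[bc cp].
- by case=> <-.
- by move=> ew ma; apply: tr bc _ => //; exact: IH vw cp ew ma.
- by case=> <- _; case/andP: vc => ->.
Qed.

Lemma size_letters w :
  size (pmap letter1 w) + size (pmap letter2 w) = size w + count is_word w.
Proof. by elim: w => //= -[a|b|a b] w IH /=; rewrite !(addSn, addnS) IH. Qed.

(** A common interface for a shuffle and for the block order of check and hat. The last four fields
    express that words sit among the other labels where S^A sits between S^- and S^+. *)
Record word_order (le1 : rel L1) (le2 : rel L2) (le : rel W) : Prop := WordOrder {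
  wo_order : partial_order le;
  wo_total : forall u v, side u != side v -> le u v || le v u;
  wo_11 : forall a b, le (Lab1 _ a) (Lab1 _ b) = le1 a b;
  wo_22 : forall a b, le (Lab2 _ a) (Lab2 _ b) = le2 a b;
  wo_ww : forall a b a' b',
    le (Word a b) (Word a' b') = le1 a a' && (le1 a' a ==> le2 b b');
  wo_w1 : forall a b c, md1 a -> ~~ md1 c -> le (Word a b) (Lab1 _ c) = le1 a c;
  wo_1w : forall a b c, md1 a -> ~~ md1 c -> le (Lab1 _ c) (Word a b) = le1 c a;
  wo_w2 : forall a b c, md2 b -> ~~ md2 c -> le (Word a b) (Lab2 _ c) = le2 b c;
  wo_2w : forall a b c, md2 b -> ~~ md2 c -> le (Lab2 _ c) (Word a b) = le2 c b
}.

Section WordOrderTheory.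
Variables (le1 : rel L1) (le2 : rel L2) (le : rel W).
Hypothesis wo : word_order le1 le2 le.

Lemma wo_cross_transitive : cross_transitive le.
Proof. by move=> u v t _; have [_ _ tr] := wo_order wo; exact: tr. Qed.

Lemma wo_cross_asymmetric : cross_asymmetric le.
Proof.
have [_ anti _] := wo_order wo.
by move=> a b ab ba; have := anti (Lab1 L2 a) (Lab2 L1 b); rewrite ab ba => /(_ isT).
Qed.

(** Comparability reverses one of the two failures: [le v u] with [le u t] would give [le v t], and
    [le t v] with [le u t] would give [le u v]. *)
Lemma wo_cross_transitive_desc : cross_transitive (fun u v => ~~ le u v).
Proof.
have [_ _ tr] := wo_order wo.
move=> u v t /orP[/(wo_total wo)|/(wo_total wo)] + /negbTE uv /negbTE vt;
  rewrite ?uv ?vt /= => h; apply/negP => ut.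
- by rewrite (tr _ _ _ h ut) in vt.
- by rewrite (tr _ _ _ ut h) in uv.
Qed.

Lemma wo_cross_asymmetric_desc : cross_asymmetric (fun u v => ~~ le u v).
Proof.
move=> a b /negbTE ab /negbTE ba.
by have := wo_total wo (isT : side (Lab1 L2 a) != side (Lab2 L1 b)); rewrite ab ba.
Qed.

Lemma wo_letter1 u v a b : valid u -> valid v -> ~~ (is_word u && is_word v) ->
  letter1 u = Some a -> letter1 v = Some b -> le u v = le1 a b.
Proof.
case: u => [x|//|x x']; case: v => [y|//|y y'] //= vu vv _ [<-] [<-].
- exact: (wo_11 wo).
- by case/andP: vv => vy _; rewrite (wo_1w wo).
- by case/andP: vu => vx _; rewrite (wo_w1 wo).
Qed.

Lemma wo_letter2 u v a b : valid u -> valid v -> ~~ (is_word u && is_word v) ->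
  letter2 u = Some a -> letter2 v = Some b -> le u v = le2 a b.
Proof.
case: u => [//|x|x x']; case: v => [//|y|y y'] //= vu vv _ [<-] [<-].
- exact: (wo_22 wo).
- by case/andP: vv => _ vy; rewrite (wo_2w wo).
- by case/andP: vu => _ vx; rewrite (wo_w2 wo).
Qed.

Lemma letter1_side u v : letter1 u = None -> letter1 v -> side u != side v.
Proof. by case: u => // ?; case: v. Qed.

Lemma letter2_side u v : letter2 u = None -> letter2 v -> side u != side v.
Proof. by case: u => // ?; case: v. Qed.

Lemma increasing_letters w : all valid w -> count is_word w <= 1 -> sorted le w ->
  sorted le1 (pmap letter1 w) /\ sorted le2 (pmap letter2 w).
Proof.
move=> vw cw sw; split.
- apply: sorted_letters wo_cross_transitive letter1_side _ vw cw sw.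
  by move=> u v a b vu vv nw fu fv; rewrite (wo_letter1 vu vv nw fu fv).
- apply: sorted_letters wo_cross_transitive letter2_side _ vw cw sw.
  by move=> u v a b vu vv nw fu fv; rewrite (wo_letter2 vu vv nw fu fv).
Qed.

Lemma descending_letters w : all valid w -> count is_word w <= 1 -> descending le w ->
  descending le1 (pmap letter1 w) /\ descending le2 (pmap letter2 w).
Proof.
move=> vw cw sw; split.
- apply: sorted_letters wo_cross_transitive_desc letter1_side _ vw cw sw.
  by move=> u v a b vu vv nw fu fv; rewrite (wo_letter1 vu vv nw fu fv).
- apply: sorted_letters wo_cross_transitive_desc letter2_side _ vw cw sw.
  by move=> u v a b vu vv nw fu fv; rewrite (wo_letter2 vu vv nw fu fv).
Qed.

End WordOrderTheory.

End LabelWords.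

(** * The CL-property and descending chains of the products *)

Section ProductPaths.
Context {d1 d2 : Order.disp_t} {T1 : finTBPOrderType d1} {T2 : finTBPOrderType d2}.
Context {L1 L2 : Type}.
Notation T := (T1 *p T2).
Notation W := (wlabel L1 L2).
Variables (k : pkind) (md1 : pred L1) (md2 : pred L2).
Variables (le1 : rel L1) (le2 : rel L2) (le : rel W).
Variables (lam1 : labeling T1 L1) (lam2 : labeling T2 L2) (lam : labeling T W).
Implicit Types (x y z : T) (p : seq T) (r : {set T}).

Notation Q := (pp k [set: T1] [set: T2]).
Notation proj1 := (proj_path (fun z : T => z.1 : T1)).
Notation proj2 := (proj_path (fun z : T => z.2 : T2)).
Notation rooted r x := (maxchain (below Q x) r).

(* The edges of a factor whose label must lie in S^A. *)
Definition special {d} {P : finTBPOrderType d} (a b : P) : bool :=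
  match k with PX => false | PC => a == \bot%O | PH => b == \top%O end.

Hypothesis nd : nontrivial_factors (T1 := T1) (T2 := T2) k.
Hypothesis wo : word_order md1 md2 le1 le2 le.
Hypothesis CL1 : CL_labeling [set: T1] le1 lam1.
Hypothesis CL2 : CL_labeling [set: T2] le2 lam2.
Hypothesis special1 : forall (r : {set T1}) a b, covers [set: T1] a b ->
  maxchain (below [set: T1] a) r -> md1 (lam1 r a b) = special a b.
Hypothesis special2 : forall (r : {set T2}) a b, covers [set: T2] a b ->
  maxchain (below [set: T2] a) r -> md2 (lam2 r a b) = special a b.
Hypothesis lam_step1 : forall r x y, good k x -> good k y ->
  covers [set: T1] x.1 y.1 -> x.2 = y.2 ->
  lam r x y = Lab1 _ (lam1 (proj1_chain r) x.1 y.1).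
Hypothesis lam_step2 : forall r x y, good k x -> good k y ->
  x.1 = y.1 -> covers [set: T2] x.2 y.2 ->
  lam r x y = Lab2 _ (lam2 (proj2_chain r) x.2 y.2).
Hypothesis lam_step12 : forall r x y, good k x -> good k y -> wedge k x y ->
  covers [set: T1] x.1 y.1 -> covers [set: T2] x.2 y.2 ->
  lam r x y = Word (lam1 (proj1_chain r) x.1 y.1) (lam2 (proj2_chain r) x.2 y.2).

Let in1 (a : T1) : a \in [set: T1]. Proof. exact: in_setT. Qed.
Let in2 (a : T2) : a \in [set: T2]. Proof. exact: in_setT. Qed.
Let ge1 : {in [set: T1], forall a, (\bot <= a)%O}. Proof. by move=> a _; exact: le0x. Qed.
Let ge2 : {in [set: T2], forall a, (\bot <= a)%O}. Proof. by move=> a _; exact: le0x. Qed.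
Let botQ : ((\bot, \bot)%O : T) \in Q.
Proof. exact: bot_in_pp. Qed.

Lemma in_Q x : (x \in Q) = good k x.
Proof. by rewrite in_pp !in_setT. Qed.

Lemma rooted_proj1 r x : good k x -> rooted r x ->
  maxchain (below [set: T1] x.1) (proj1_chain r).
Proof.
move=> gx; rewrite (below_itv _ ge1) below_pp => mr.
have xQ : x \in Q by rewrite in_Q.
exact: (maxchain_proj (@covers_pp_proj1 _ _ _ _ k _ _) botQ xQ (bot_le x) (in1 _) mr).
Qed.

Lemma rooted_proj2 r x : good k x -> rooted r x ->
  maxchain (below [set: T2] x.2) (proj2_chain r).
Proof.
move=> gx; rewrite (below_itv _ ge2) below_pp => mr.
have xQ : x \in Q by rewrite in_Q.
exact: (maxchain_proj (@covers_pp_proj2 _ _ _ _ k _ _) botQ xQ (bot_le x) (in2 _) mr).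
Qed.

Lemma rooted_mem r x : good k x -> rooted r x -> x \in r.
Proof.
move=> gx; rewrite below_pp => mr.
have xQ : x \in Q by rewrite in_Q.
have [p [_ lp ->]] := maxchain_itv_path botQ xQ (bot_le x) mr.
by rewrite inE -lp mem_last.
Qed.

Lemma rooted_step r x y : rooted r x -> covers Q x y -> rooted (y |: r) y.
Proof. by apply: root_step botQ _ => z _; exact: bot_le. Qed.

Lemma proj1_chainU r y : proj1_chain (y |: r) = y.1 |: proj1_chain r.
Proof. by rewrite /proj1_chain imsetU1. Qed.

Lemma proj2_chainU r y : proj2_chain (y |: r) = y.2 |: proj2_chain r.
Proof. by rewrite /proj2_chain imsetU1. Qed.

Lemma proj1_chainU_eq r x y : good k x -> rooted r x -> x.1 = y.1 ->
  proj1_chain (y |: r) = proj1_chain r.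
Proof.
move=> gx mr e; rewrite proj1_chainU -e; apply/setUidPr; rewrite sub1set.
by apply/imsetP; exists x => //; exact: rooted_mem.
Qed.

Lemma proj2_chainU_eq r x y : good k x -> rooted r x -> x.2 = y.2 ->
  proj2_chain (y |: r) = proj2_chain r.
Proof.
move=> gx mr e; rewrite proj2_chainU -e; apply/setUidPr; rewrite sub1set.
by apply/imsetP; exists x => //; exact: rooted_mem.
Qed.

(** A step stationary in the first coordinate adds nothing to the projected root, because [x]
    already belongs to [r]. Later labels therefore see exactly the root of the projected path. *)
Lemma letters1 r x p : path (covers Q) x p -> rooted r x ->
  pmap letter1 (label_word lam r (x :: p)) =
  label_word lam1 (proj1_chain r) (x.1 :: proj1 x p).
Proof.
elim: p x r => //= y p IH x r /andP[xy yp] mr.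
have [gx gy] := covers_good xy.
have := IH y (y |: r) yp (rooted_step mr xy) => {}IH.
case: (covers_pp_step xy) => [c1 e2|e1 c2|w c1 c2].
- rewrite (lam_step1 r gx gy c1 e2) (lt_eqF (covers_lt c1)) /= IH.
  by rewrite proj1_chainU.
- rewrite (lam_step2 r gx gy e1 c2) e1 eqxx /= IH.
  by rewrite (proj1_chainU_eq gx mr e1).
- rewrite (lam_step12 r gx gy w c1 c2) (lt_eqF (covers_lt c1)) /= IH.
  by rewrite proj1_chainU.
Qed.

Lemma letters2 r x p : path (covers Q) x p -> rooted r x ->
  pmap letter2 (label_word lam r (x :: p)) =
  label_word lam2 (proj2_chain r) (x.2 :: proj2 x p).
Proof.
elim: p x r => //= y p IH x r /andP[xy yp] mr.
have [gx gy] := covers_good xy.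
have := IH y (y |: r) yp (rooted_step mr xy) => {}IH.
case: (covers_pp_step xy) => [c1 e2|e1 c2|w c1 c2].
- rewrite (lam_step1 r gx gy c1 e2) e2 eqxx /= IH.
  by rewrite (proj2_chainU_eq gx mr e2).
- rewrite (lam_step2 r gx gy e1 c2) (lt_eqF (covers_lt c2)) /= IH.
  by rewrite proj2_chainU.
- rewrite (lam_step12 r gx gy w c1 c2) (lt_eqF (covers_lt c2)) /= IH.
  by rewrite proj2_chainU.
Qed.

Lemma special_step1 x y : good k x -> good k y -> (x.1 < y.1)%O -> x.2 = y.2 ->
  special x.1 y.1 = false.
Proof. by move=> gx gy lt e; apply/negbTE: (step1_good gx gy lt e); case: (k). Qed.

Lemma special_step2 x y : good k x -> good k y -> x.1 = y.1 -> (x.2 < y.2)%O ->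
  special x.2 y.2 = false.
Proof.
move=> + + e lt; rewrite /good /special e; case: (k) => // /eqP ex /eqP ey.
- by rewrite -ex ey (eq_botF lt).
- by rewrite -ey ex (eq_topF lt).
Qed.

Lemma special_step12 x y : good k x -> good k y -> wedge k x y ->
  special x.1 y.1 && special x.2 y.2.
Proof.
move=> gx gy w; have := wedge_bot_top gx gy w; rewrite /special.
by case: (k) => // ->; rewrite !eqxx.
Qed.

Lemma valid_word r x p : path (covers Q) x p -> rooted r x ->
  all (valid md1 md2) (label_word lam r (x :: p)).
Proof.
elim: p x r => // y p IH x r /= /andP[xy yp] mr.
have [gx gy] := covers_good xy.
have mr1 := rooted_proj1 gx mr; have mr2 := rooted_proj2 gx mr.
have := IH y (y |: r) yp (rooted_step mr xy); rewrite /= => ->; rewrite andbT.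
case: (covers_pp_step xy) => [c1 e2|e1 c2|w c1 c2].
- rewrite (lam_step1 r gx gy c1 e2) /= special1 //.
  by rewrite (special_step1 gx gy (covers_lt c1) e2).
- rewrite (lam_step2 r gx gy e1 c2) /= special2 //.
  by rewrite (special_step2 gx gy e1 (covers_lt c2)).
- rewrite (lam_step12 r gx gy w c1 c2) /= special1 // special2 //.
  exact: special_step12.
Qed.

Lemma size_label_word {d} {P : finPOrderType d} {L} (l : labeling P L)
    (r : {set P}) (x : P) (p : seq P) :
  size (label_word l r (x :: p)) = size p.
Proof. by elim: p x r => //= y p IH x r; rewrite IH. Qed.

(** Letters are counted twice: as labels plus words, and as edges plus [n12]. Hence the number of
    words is [n12]. *)
Lemma one_word r x p : path (covers Q) x p -> rooted r x ->
  count (@is_word L1 L2) (label_word lam r (x :: p)) <= 1.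
Proof.
move=> xp mr; have := size_letters (label_word lam r (x :: p)).
rewrite (letters1 xp mr) (letters2 xp mr) !size_label_word (size_proj xp).
by move=> /addnI <-; rewrite /n12; case: (k) => //; case: (_ && _).
Qed.

Lemma increasing_proj r x p : path (covers Q) x p -> rooted r x ->
  sorted le (label_word lam r (x :: p)) ->
  sorted le1 (label_word lam1 (proj1_chain r) (x.1 :: proj1 x p)) /\
  sorted le2 (label_word lam2 (proj2_chain r) (x.2 :: proj2 x p)).
Proof.
move=> xp mr; rewrite -(letters1 xp mr) -(letters2 xp mr).
exact: (increasing_letters wo (valid_word xp mr) (one_word xp mr)).
Qed.

Lemma descending_proj r x p : path (covers Q) x p -> rooted r x ->
  descending le (label_word lam r (x :: p)) ->
  descending le1 (label_word lam1 (proj1_chain r) (x.1 :: proj1 x p)) /\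
  descending le2 (label_word lam2 (proj2_chain r) (x.2 :: proj2 x p)).
Proof.
move=> xp mr; rewrite -(letters1 xp mr) -(letters2 xp mr).
exact: (descending_letters wo (valid_word xp mr) (one_word xp mr)).
Qed.

(** The two paths share their projected words. Starting in the first factor, one yields [rho] from
    the first letter of factor one to that of factor two; the other yields the reverse. *)
Lemma merge12 (rho : rel W) r x z z' p p' :
  cross_transitive rho -> cross_asymmetric rho ->
  path (covers Q) x (z :: p) -> path (covers Q) x (z' :: p') -> rooted r x ->
  covers [set: T1] x.1 z.1 -> x.2 = z.2 -> x.1 = z'.1 -> covers [set: T2] x.2 z'.2 ->
  sorted rho (label_word lam r [:: x, z & p]) ->
  sorted rho (label_word lam r [:: x, z' & p']) ->
  proj1 x (z :: p) = proj1 x (z' :: p') -> proj2 x (z :: p) = proj2 x (z' :: p') ->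
  False.
Proof.
move=> tr asym xp xp' mr c1 e2 e1 c2 sp sp' E1 E2.
have [xz xz'] : covers Q x z /\ covers Q x z' by case/andP: xp => ->; case/andP: xp'.
have [gx gz] := covers_good xz; have [_ gz'] := covers_good xz'.
have vp := valid_word xp mr; have vp' := valid_word xp' mr.
have l2 := letters2 xp mr; have l1 := letters1 xp' mr.
rewrite E2 /= (lt_eqF (covers_lt c2)) in l2.
rewrite -E1 /= (lt_eqF (covers_lt c1)) in l1.
rewrite /= (lam_step1 r gx gz c1 e2) in sp vp l2.
rewrite /= (lam_step2 r gx gz' e1 c2) in sp' vp' l1.
case/andP: vp => v1 vp; case/andP: vp' => v2 vp'.
apply: (asym (lam1 (proj1_chain r) x.1 z.1) (lam2 (proj2_chain r) x.2 z'.2)).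
- exact: (cross_letter1 tr vp sp l2 v2).
- exact: (cross_letter2 tr vp' sp' l1 v1).
Qed.

(** It suffices that the first vertices agree. Starts in different factors contradict [merge12], and
    a word edge never competes with an ordinary edge from the same vertex. *)
Lemma merge_unique (rho : rel W) r x p p' :
  cross_transitive rho -> cross_asymmetric rho ->
  path (covers Q) x p -> path (covers Q) x p' -> rooted r x ->
  sorted rho (label_word lam r (x :: p)) -> sorted rho (label_word lam r (x :: p')) ->
  proj1 x p = proj1 x p' -> proj2 x p = proj2 x p' -> p = p'.
Proof.
move=> tr asym; elim: p x r p' => [|z p IH] x r [|z' p'] //.
- move=> _ /andP[xz _] _ _ _ /=; case: (covers_pp_step xz) => [c1 e2|e1 c2|w c1 c2].
  + by rewrite (lt_eqF (covers_lt c1)).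
  + by rewrite (lt_eqF (covers_lt c2)).
  + by rewrite (lt_eqF (covers_lt c1)).
- move=> /andP[xz _] _ _ _ _ /=; case: (covers_pp_step xz) => [c1 e2|e1 c2|w c1 c2].
  + by rewrite (lt_eqF (covers_lt c1)).
  + by rewrite (lt_eqF (covers_lt c2)).
  + by rewrite (lt_eqF (covers_lt c1)).
move=> xp xp' mr sp sp' E1 E2.
have /andP[xz zp] := xp; have /andP[xz' zp'] := xp'.
have [gx gz] := covers_good xz; have [_ gz'] := covers_good xz'.
suff e : z = z'.
  rewrite -{z'}e in xp' xz' zp' gz' sp' E1 E2 *; congr (_ :: _).
  apply: (IH z (z |: r)) => //; first exact: rooted_step xz.
  - by move: sp => /path_sorted.
  - by move: sp' => /path_sorted.
  - by move: E1 => /=; case: eqP => // _ [].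
  - by move: E2 => /=; case: eqP => // _ [].
case: (covers_pp_step xz) => [c1 e2|e1 c2|w c1 c2];
  case: (covers_pp_step xz') => [c1' e2'|e1' c2'|w' c1' c2'].
- move: E1 => /=; rewrite (lt_eqF (covers_lt c1)) (lt_eqF (covers_lt c1')) => -[e _].
  by apply: prod_eqP; rewrite // -e2.
- by case: (merge12 tr asym xp xp' mr c1 e2 e1' c2' sp sp' E1 E2).
- by have := step1_good gx gz (covers_lt c1) e2; rewrite (covers_wedge xz' w' xz).
- by case: (merge12 tr asym xp' xp mr c1' e2' e1 c2 sp' sp (esym E1) (esym E2)).
- move: E2 => /=; rewrite (lt_eqF (covers_lt c2)) (lt_eqF (covers_lt c2')) => -[e _].
  by apply: prod_eqP; rewrite // -e1.
- by have := step2_good gx gz e1 (covers_lt c2); rewrite (covers_wedge xz' w' xz).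
- by have := step1_good gx gz' (covers_lt c1') e2'; rewrite (covers_wedge xz w xz').
- by have := step2_good gx gz' e1' (covers_lt c2'); rewrite (covers_wedge xz w xz').
- move: E1 E2 => /=; rewrite (lt_eqF (covers_lt c1)) (lt_eqF (covers_lt c1')).
  rewrite (lt_eqF (covers_lt c2)) (lt_eqF (covers_lt c2')) => -[e _] [e' _].
  exact: prod_eqP.
Qed.

(** Only the label after the new one matters. If it lies in the first factor or is a word, the
    projected word decides; otherwise it is the first letter of factor two, which the last
    hypothesis handles. *)
Lemma merge_cons1 r x z q :
  covers Q x z -> rooted r x -> covers [set: T1] x.1 z.1 -> x.2 = z.2 ->
  path (covers Q) z q -> sorted le (label_word lam (z |: r) (z :: q)) ->
  sorted le1 (label_word lam1 (proj1_chain r) [:: x.1, z.1 & proj1 z q]) ->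
  (forall b t, label_word lam2 (proj2_chain r) (x.2 :: proj2 z q) = b :: t ->
     ~~ md2 b -> le (Lab1 _ (lam1 (proj1_chain r) x.1 z.1)) (Lab2 _ b)) ->
  sorted le (label_word lam r [:: x, z & q]).
Proof.
move=> xz mr c1 e2; have [gx gz] := covers_good xz.
have mr' := rooted_step mr xz.
have m1 := rooted_proj1 gz mr'; have m2 := rooted_proj2 gz mr'.
rewrite /= (lam_step1 r gx gz c1 e2).
case: q => [//|y q] /= /andP[zy _] ->; rewrite andbT.
have [_ gy] := covers_good zy.
case: (covers_pp_step zy) => [c1' e2'|e1' c2'|w' c1' c2'].
- rewrite (lam_step1 _ gz gy c1' e2') (lt_eqF (covers_lt c1')) (wo_11 wo) proj1_chainU.
  by move=> /= /andP[].
- rewrite (lam_step2 _ gz gy e1' c2') (lt_eqF (covers_lt c2')) => _ /=.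
  rewrite -e2 (proj2_chainU_eq gx mr e2) in c2' m2 *; apply; first by [].
  by rewrite special2 //= e2 (special_step2 gz gy e1') // -e2; exact: covers_lt c2'.
- rewrite (lam_step12 _ gz gy w' c1' c2') (lt_eqF (covers_lt c1')).
  have /andP[s1 s2] := special_step12 gz gy w'.
  rewrite (wo_1w wo) ?special1 ?s1 //.
  + by rewrite proj1_chainU => /= /andP[].
  + by rewrite (special_step1 gx gz (covers_lt c1) e2).
  + exact: rooted_proj1.
Qed.

Lemma merge_cons2 r x z q :
  covers Q x z -> rooted r x -> x.1 = z.1 -> covers [set: T2] x.2 z.2 ->
  path (covers Q) z q -> sorted le (label_word lam (z |: r) (z :: q)) ->
  sorted le2 (label_word lam2 (proj2_chain r) [:: x.2, z.2 & proj2 z q]) ->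
  (forall a t, label_word lam1 (proj1_chain r) (x.1 :: proj1 z q) = a :: t ->
     ~~ md1 a -> le (Lab2 _ (lam2 (proj2_chain r) x.2 z.2)) (Lab1 _ a)) ->
  sorted le (label_word lam r [:: x, z & q]).
Proof.
move=> xz mr e1 c2; have [gx gz] := covers_good xz.
have mr' := rooted_step mr xz.
have m1 := rooted_proj1 gz mr'; have m2 := rooted_proj2 gz mr'.
rewrite /= (lam_step2 r gx gz e1 c2).
case: q => [//|y q] /= /andP[zy _] ->; rewrite andbT.
have [_ gy] := covers_good zy.
case: (covers_pp_step zy) => [c1' e2'|e1' c2'|w' c1' c2'].
- rewrite (lam_step1 _ gz gy c1' e2') (lt_eqF (covers_lt c1')) => _ /=.
  rewrite -e1 (proj1_chainU_eq gx mr e1) in c1' m1 *; apply; first by [].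
  by rewrite special1 //= e1 (special_step1 gz gy) // -e1; exact: covers_lt c1'.
- rewrite (lam_step2 _ gz gy e1' c2') (lt_eqF (covers_lt c2')) (wo_22 wo) proj2_chainU.
  by move=> /= /andP[].
- rewrite (lam_step12 _ gz gy w' c1' c2') (lt_eqF (covers_lt c2')).
  have /andP[s1 s2] := special_step12 gz gy w'.
  rewrite (wo_2w wo) ?special2 ?s2 //.
  + by rewrite proj2_chainU => /= /andP[].
  + by rewrite (special_step2 gx gz e1 (covers_lt c2)).
  + exact: rooted_proj2.
Qed.

Lemma merge_cons12 r x z q :
  covers Q x z -> rooted r x -> wedge k x z ->
  covers [set: T1] x.1 z.1 -> covers [set: T2] x.2 z.2 ->
  path (covers Q) z q -> sorted le (label_word lam (z |: r) (z :: q)) ->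
  sorted le1 (label_word lam1 (proj1_chain r) [:: x.1, z.1 & proj1 z q]) ->
  sorted le2 (label_word lam2 (proj2_chain r) [:: x.2, z.2 & proj2 z q]) ->
  sorted le (label_word lam r [:: x, z & q]).
Proof.
move=> xz mr w c1 c2; have [gx gz] := covers_good xz.
have mr' := rooted_step mr xz.
have m1 := rooted_proj1 gz mr'; have m2 := rooted_proj2 gz mr'.
have n1 := rooted_proj1 gx mr; have n2 := rooted_proj2 gx mr.
have /andP[s1 s2] := special_step12 gx gz w.
rewrite /= (lam_step12 r gx gz w c1 c2).
case: q => [//|y q] /= /andP[zy _] ->; rewrite andbT.
have [_ gy] := covers_good zy.
case: (covers_pp_step zy) => [c1' e2'|e1' c2'|w' c1' c2'].
- rewrite (lam_step1 _ gz gy c1' e2') (lt_eqF (covers_lt c1')) /=.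
  rewrite (wo_w1 wo) ?special1 ?s1 // ?proj1_chainU; first by case/andP.
  by rewrite (special_step1 gz gy (covers_lt c1') e2').
- rewrite (lam_step2 _ gz gy e1' c2') (lt_eqF (covers_lt c2')) /=.
  rewrite (wo_w2 wo) ?special2 ?s2 // ?proj2_chainU; first by move=> _ /andP[].
  by rewrite (special_step2 gz gy e1' (covers_lt c2')).
- rewrite (lam_step12 _ gz gy w' c1' c2') (lt_eqF (covers_lt c1')) (lt_eqF (covers_lt c2')).
  rewrite (wo_ww wo) proj1_chainU proj2_chainU /= => /andP[-> _] /andP[-> _].
  by rewrite implybT.
Qed.

Lemma good_step1 x (a1 : T1) (a2 : T2) : good k x -> (x.1 < a1)%O -> (x.2 < a2)%O ->
  ~~ special x.1 a1 -> good k ((a1, x.2) : T).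
Proof.
rewrite /good /special; case: (k) => //= /eqP e l1 l2.
- by move=> /negbTE n; rewrite -e n (eq_botF l1).
- by move=> /negbTE n; rewrite n (eq_topF l2).
Qed.

Lemma good_step2 x (a1 : T1) (a2 : T2) : good k x -> (x.1 < a1)%O -> (x.2 < a2)%O ->
  ~~ special x.2 a2 -> good k ((x.1, a2) : T).
Proof.
rewrite /good /special; case: (k) => //= /eqP e l1 l2.
- by move=> /negbTE n; rewrite e n (eq_botF l2).
- by move=> /negbTE n; rewrite n (eq_topF l1).
Qed.

(** Serves the merge when the second path is used up: goodness of the target [y] then rules out that
    the remaining steps meet the glued end. *)
Lemma good_last1 x y (a1 : T1) : good k x -> good k y -> (x.1 < a1)%O -> (a1 <= y.1)%O ->
  x.2 = y.2 -> good k ((a1, x.2) : T).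
Proof.
rewrite /good; case: (k) => //= /eqP gx /eqP gy l1 l2 e.
- by rewrite (eq_botF l1) e -gy (eq_botF (lt_le_trans l1 l2)).
- rewrite -gx (eq_topF l1); apply/eqP/negbTE/eqP => e1.
  by move: gy l2; rewrite -e -gx (eq_topF l1) e1 le1x => ->.
Qed.

Lemma good_last2 x y (a2 : T2) : good k x -> good k y -> (x.2 < a2)%O -> (a2 <= y.2)%O ->
  x.1 = y.1 -> good k ((x.1, a2) : T).
Proof.
rewrite /good; case: (k) => //= /eqP gx /eqP gy l1 l2 e.
- by rewrite (eq_botF l1) e gy (eq_botF (lt_le_trans l1 l2)).
- rewrite gx (eq_topF l1); apply/eqP/esym/negbTE/eqP => e1.
  by move: gy l2; rewrite -e gx (eq_topF l1) e1 le1x => <-.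
Qed.

Lemma merge_exists r x y (p1 : seq T1) (p2 : seq T2) :
  good k x -> good k y -> rooted r x ->
  path (covers [set: T1]) x.1 p1 -> last x.1 p1 = y.1 ->
  path (covers [set: T2]) x.2 p2 -> last x.2 p2 = y.2 ->
  sorted le1 (label_word lam1 (proj1_chain r) (x.1 :: p1)) ->
  sorted le2 (label_word lam2 (proj2_chain r) (x.2 :: p2)) ->
  exists p, [/\ path (covers Q) x p, proj1 x p = p1, proj2 x p = p2 &
                sorted le (label_word lam r (x :: p))].
Proof.
(* Each step shortens one or both words, so the induction bounds their total length. *)
move: {2}(size p1 + size p2) (leqnn (size p1 + size p2)) => n.
elim: n r x p1 p2 => [|n IH] r x p1 p2.
  by case: p1 => [|a1 p1]; case: p2 => [|a2 p2] // *; exists [::].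
move=> sz gx gy mr P1 E1 P2 E2 S1 S2.
have step1 a1 q1 : p1 = a1 :: q1 -> good k ((a1, x.2) : T) ->
    (forall b t, label_word lam2 (proj2_chain r) (x.2 :: p2) = b :: t ->
     ~~ md2 b -> le (Lab1 _ (lam1 (proj1_chain r) x.1 a1)) (Lab2 _ b)) ->
    exists p, [/\ path (covers Q) x p, proj1 x p = p1, proj2 x p = p2 &
                sorted le (label_word lam r (x :: p))].
  move=> ep; rewrite {}ep /= in sz P1 E1 S1 *; case/andP: P1 => c1 P1 gz hle.
  set z : T := (a1, x.2).
  have xz : covers Q x z by apply: step_covers; rewrite ?in_Q //; exact: Step1.
  have [||q [zq Q1 Q2 Sq]] := IH (z |: r) z q1 p2 sz gz gy (rooted_step mr xz) P1 E1 P2 E2.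
  - by rewrite proj1_chainU; move: S1 => /path_sorted.
  - by rewrite (@proj2_chainU_eq _ x).
  exists (z :: q); split.
  - by rewrite /= xz.
  - by rewrite /= (lt_eqF (covers_lt c1)) Q1.
  - by rewrite /= eqxx Q2.
  - by apply: merge_cons1; rewrite // ?Q1 ?Q2.
have step2 a2 q2 : p2 = a2 :: q2 -> good k ((x.1, a2) : T) ->
    (forall a t, label_word lam1 (proj1_chain r) (x.1 :: p1) = a :: t ->
     ~~ md1 a -> le (Lab2 _ (lam2 (proj2_chain r) x.2 a2)) (Lab1 _ a)) ->
    exists p, [/\ path (covers Q) x p, proj1 x p = p1, proj2 x p = p2 &
                sorted le (label_word lam r (x :: p))].
  move=> ep; rewrite {}ep /= in sz P2 E2 S2 *; case/andP: P2 => c2 P2 gz hle.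
  rewrite addnS ltnS in sz.
  set z : T := (x.1, a2).
  have xz : covers Q x z by apply: step_covers; rewrite ?in_Q //; exact: Step2.
  have [||q [zq Q1 Q2 Sq]] := IH (z |: r) z p1 q2 sz gz gy (rooted_step mr xz) P1 E1 P2 E2.
  - by rewrite (@proj1_chainU_eq _ x).
  - by rewrite proj2_chainU; move: S2 => /path_sorted.
  exists (z :: q); split.
  - by rewrite /= xz.
  - by rewrite /= eqxx Q1.
  - by rewrite /= (lt_eqF (covers_lt c2)) Q2.
  - by apply: merge_cons2; rewrite // ?Q1 ?Q2.
case: p1 p2 => [|a1 p1] [|a2 p2] in sz P1 E1 P2 E2 S1 S2 step1 step2 *.
- by exists [::].
- apply: (step2 a2 p2) => //; case/andP: P2 => c2 P2.
  apply: good_last2 gy (covers_lt c2) _ _ => //.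
  by rewrite -E2; apply: (path_lt_last (path_covers_lt P2)); rewrite mem_head.
- apply: (step1 a1 p1) => //; case/andP: P1 => c1 P1.
  apply: good_last1 gy (covers_lt c1) _ _ => //.
  by rewrite -E1; apply: (path_lt_last (path_covers_lt P1)); rewrite mem_head.
have /andP[c1 P1'] := P1; have /andP[c2 P2'] := P2.
have l1 := covers_lt c1; have l2 := covers_lt c2.
have r1 := rooted_proj1 gx mr; have r2 := rooted_proj2 gx mr.
(* Two special steps are fused. A single special step must wait for its partner, so the other factor
   moves, and the order condition is vacuous because the waiting letter lies in S^A. With none
   special, the smaller letter goes first. *)
have [s1|n1] := boolP (special x.1 a1); have [s2|n2] := boolP (special x.2 a2).
- set z : T := (a1, a2).
  have w : wedge k x z by move: s1; rewrite /special /wedge; case: (k).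
  have gz : good k z.
    move: s1 s2; rewrite /special /good; case: (k) => //=.
    + by rewrite (eq_botF l1) (eq_botF l2).
    + by move=> -> ->.
  have xz : covers Q x z by apply: step_covers; rewrite ?in_Q //; exact: Step12.
  have sz' : size p1 + size p2 <= n.
    by move: sz => /=; rewrite addSn addnS ltnS => /ltnW.
  have [||q [zq Q1 Q2 Sq]] := IH (z |: r) z p1 p2 sz' gz gy (rooted_step mr xz) P1' E1 P2' E2.
  - by rewrite proj1_chainU; move: S1 => /path_sorted.
  - by rewrite proj2_chainU; move: S2 => /path_sorted.
  exists (z :: q); split.
  - by rewrite /= xz.
  - by rewrite /= (lt_eqF l1) Q1.
  - by rewrite /= (lt_eqF l2) Q2.
  - by apply: merge_cons12; rewrite // ?Q1 ?Q2.
- apply: (step2 a2 p2) => //; first exact: good_step2 gx l1 l2 n2.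
  by move=> a t [<- _]; rewrite special1 // s1.
- apply: (step1 a1 p1) => //; first exact: good_step1 gx l1 l2 n1.
  by move=> b t [<- _]; rewrite special2 // s2.
have := wo_total wo (isT : side (Lab1 L2 (lam1 (proj1_chain r) x.1 a1)) !=
                           side (Lab2 L1 (lam2 (proj2_chain r) x.2 a2))).
case/orP => h.
- apply: (step1 a1 p1) => //; first exact: good_step1 gx l1 l2 n1.
  by move=> b t [<- _].
- apply: (step2 a2 p2) => //; first exact: good_step2 gx l1 l2 n2.
  by move=> b t [<- _].
Qed.

(** For hat, an element covered by the top has no other upper cover; for check, only the lower end
    counts. *)
Lemma special_atom {d} {P : finTBPOrderType d} (a b c : P) :
  covers [set: P] a b -> covers [set: P] a c -> special a b -> special a c.
Proof.
rewrite /special; case: (k) => //= ab ac /eqP e.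
have [//|nc] := eqVneq c \top%O.
have [_ _ _ /(_ c (in_setT _) (covers_lt ac))] := coversP _ _ _ ab.
by rewrite e lt_neqAle nc lex1 => /(_ isT).
Qed.

(** The increasing chain still has to move in the second coordinate. Its first letter there lies
    above its first label by the merge order, and below the label of [z'] by [CL_first] in the
    second factor. The two sides differ, so the inequality is strict. *)
Lemma first_label12 r x y z p z' :
  rooted r x -> path (covers Q) x (z :: p) -> last z p = y ->
  sorted le (label_word lam r [:: x, z & p]) ->
  covers Q x z' -> (z' <= y)%O ->
  covers [set: T1] x.1 z.1 -> x.2 = z.2 -> x.1 = z'.1 -> covers [set: T2] x.2 z'.2 ->
  le (lam r x z) (lam r x z') && ~~ le (lam r x z') (lam r x z).
Proof.
move=> mr xp ly sp xz' zy' c1 e2 e1 c2.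
have xz : covers Q x z by case/andP: xp.
have [gx gz] := covers_good xz; have [_ gz'] := covers_good xz'.
have r2 := rooted_proj2 gx mr; have [_ _ tr] := wo_order wo.
have vp := valid_word xp mr; have l2 := letters2 xp mr.
have [_ S2] := increasing_proj xp mr sp.
have P2 := proj_pathP (@covers_pp_proj2 _ _ _ _ k _ _) xp.
have last2 := last_proj_path (fun z : T => z.2 : T2) x (z :: p).
move: zy'; rewrite leEprod -ly => /andP[_ le2y].
move: sp vp l2; rewrite /= (lam_step1 r gx gz c1 e2) (lam_step2 r gx gz' e1 c2).
move=> sp /andP[_ vp] l2.
suff h : le (Lab1 _ (lam1 (proj1_chain r) x.1 z.1)) (Lab2 _ (lam2 (proj2_chain r) x.2 z'.2)).
  by rewrite h; apply/negP; exact: (wo_cross_asymmetric wo) h.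
have nsp : special x.2 z'.2 = false by exact: special_step2 (covers_lt c2).
move: l2 S2 P2 last2; rewrite /= e2 eqxx -e2.
case: (proj2 z p) => [|a2 q2] /= l2 S2 P2 last2.
  by move: (lt_le_trans (covers_lt c2) le2y); rewrite -last2 ltxx.
have c2' : covers [set: T2] x.2 a2 by case/andP: P2.
have h : le (Lab1 _ (lam1 (proj1_chain r) x.1 z.1)) (Lab2 _ (lam2 (proj2_chain r) x.2 a2)).
  apply: (cross_letter1 (wo_cross_transitive wo) vp sp l2).
  rewrite special2 //; apply/negP => s2.
  by rewrite (special_atom c2' c2 s2) in nsp.
apply: tr h _; rewrite (wo_22 wo).
have [->|nz] := eqVneq z'.2 a2; first by have [[rf _ _] _] := CL2; exact: rf.
have zl : (z'.2 <= last a2 q2)%O by rewrite last2.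
by have /andP[] := CL_first (in2 _) ge2 CL2 r2 P2 S2 c2 zl nz.
Qed.

Lemma first_label21 r x y z p z' :
  rooted r x -> path (covers Q) x (z :: p) -> last z p = y ->
  sorted le (label_word lam r [:: x, z & p]) ->
  covers Q x z' -> (z' <= y)%O ->
  x.1 = z.1 -> covers [set: T2] x.2 z.2 -> covers [set: T1] x.1 z'.1 -> x.2 = z'.2 ->
  le (lam r x z) (lam r x z') && ~~ le (lam r x z') (lam r x z).
Proof.
move=> mr xp ly sp xz' zy' e1 c2 c1 e2.
have xz : covers Q x z by case/andP: xp.
have [gx gz] := covers_good xz; have [_ gz'] := covers_good xz'.
have r1 := rooted_proj1 gx mr; have [_ _ tr] := wo_order wo.
have vp := valid_word xp mr; have l1 := letters1 xp mr.
have [S1 _] := increasing_proj xp mr sp.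
have P1 := proj_pathP (@covers_pp_proj1 _ _ _ _ k _ _) xp.
have last1 := last_proj_path (fun z : T => z.1 : T1) x (z :: p).
move: zy'; rewrite leEprod -ly => /andP[le1y _].
move: sp vp l1; rewrite /= (lam_step2 r gx gz e1 c2) (lam_step1 r gx gz' c1 e2).
move=> sp /andP[_ vp] l1.
suff h : le (Lab2 _ (lam2 (proj2_chain r) x.2 z.2)) (Lab1 _ (lam1 (proj1_chain r) x.1 z'.1)).
  by rewrite h; apply/negP => h'; exact: (wo_cross_asymmetric wo) h' h.
have nsp : special x.1 z'.1 = false by apply: special_step1 e2; rewrite ?(covers_lt c1).
move: l1 S1 P1 last1; rewrite /= e1 eqxx -e1.
case: (proj1 z p) => [|a1 q1] /= l1 S1 P1 last1.
  by move: (lt_le_trans (covers_lt c1) le1y); rewrite -last1 ltxx.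
have c1' : covers [set: T1] x.1 a1 by case/andP: P1.
have h : le (Lab2 _ (lam2 (proj2_chain r) x.2 z.2)) (Lab1 _ (lam1 (proj1_chain r) x.1 a1)).
  apply: (cross_letter2 (wo_cross_transitive wo) vp sp l1).
  rewrite special1 //; apply/negP => s1.
  by rewrite (special_atom c1' c1 s1) in nsp.
apply: tr h _; rewrite (wo_11 wo).
have [->|nz] := eqVneq z'.1 a1; first by have [[rf _ _] _] := CL1; exact: rf.
have zl : (z'.1 <= last a1 q1)%O by rewrite last1.
by have /andP[] := CL_first (in1 _) ge1 CL1 r1 P1 S1 c1 zl nz.
Qed.

(** Strictness settles [lexle] at the first vertex where two chains part, whatever labels follow.
    Between two word edges the second letters decide when the first coordinates agree. *)
Lemma first_label r x y z p z' :
  rooted r x -> path (covers Q) x (z :: p) -> last z p = y ->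
  sorted le (label_word lam r [:: x, z & p]) ->
  covers Q x z' -> (z' <= y)%O -> z != z' ->
  le (lam r x z) (lam r x z') && ~~ le (lam r x z') (lam r x z).
Proof.
move=> mr xp ly sp xz' zy' nz.
have xz : covers Q x z by case/andP: xp.
have [gx gz] := covers_good xz; have [_ gz'] := covers_good xz'.
have r1 := rooted_proj1 gx mr; have r2 := rooted_proj2 gx mr.
have [S1 S2] := increasing_proj xp mr sp.
have P1 := proj_pathP (@covers_pp_proj1 _ _ _ _ k _ _) xp.
have P2 := proj_pathP (@covers_pp_proj2 _ _ _ _ k _ _) xp.
have last1 := last_proj_path (fun z : T => z.1 : T1) x (z :: p).
have last2 := last_proj_path (fun z : T => z.2 : T2) x (z :: p).
have [le1y le2y] : (z'.1 <= y.1)%O /\ (z'.2 <= y.2)%O.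
  by move: zy'; rewrite leEprod => /andP.
have first1 : covers [set: T1] x.1 z.1 -> covers [set: T1] x.1 z'.1 -> z'.1 != z.1 ->
    le1 (lam1 (proj1_chain r) x.1 z.1) (lam1 (proj1_chain r) x.1 z'.1) &&
    ~~ le1 (lam1 (proj1_chain r) x.1 z'.1) (lam1 (proj1_chain r) x.1 z.1).
  move=> c1 c1' n1; rewrite /= (lt_eqF (covers_lt c1)) ly in S1 P1 last1.
  rewrite -last1 in le1y.
  exact: (CL_first (in1 _) ge1 CL1 r1 P1 S1 c1' le1y n1).
have first2 : covers [set: T2] x.2 z.2 -> covers [set: T2] x.2 z'.2 -> z'.2 != z.2 ->
    le2 (lam2 (proj2_chain r) x.2 z.2) (lam2 (proj2_chain r) x.2 z'.2) &&
    ~~ le2 (lam2 (proj2_chain r) x.2 z'.2) (lam2 (proj2_chain r) x.2 z.2).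
  move=> c2 c2' n2; rewrite /= (lt_eqF (covers_lt c2)) ly in S2 P2 last2.
  rewrite -last2 in le2y.
  exact: (CL_first (in2 _) ge2 CL2 r2 P2 S2 c2' le2y n2).
case: (covers_pp_step xz) => [c1 e2|e1 c2|w c1 c2];
  case: (covers_pp_step xz') => [c1' e2'|e1' c2'|w' c1' c2'].
- rewrite (lam_step1 r gx gz c1 e2) (lam_step1 r gx gz' c1' e2') !(wo_11 wo).
  apply: first1 => //; apply: contra nz => /eqP e1.
  by apply/eqP/prod_eqP; rewrite -?e2.
- exact: first_label12 mr xp ly sp xz' zy' c1 e2 e1' c2'.
- by have := step1_good gx gz (covers_lt c1) e2; rewrite (covers_wedge xz' w' xz).
- exact: first_label21 mr xp ly sp xz' zy' e1 c2 c1' e2'.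
- rewrite (lam_step2 r gx gz e1 c2) (lam_step2 r gx gz' e1' c2') !(wo_22 wo).
  apply: first2 => //; apply: contra nz => /eqP e2.
  by apply/eqP/prod_eqP; rewrite -?e1.
- by have := step2_good gx gz e1 (covers_lt c2); rewrite (covers_wedge xz' w' xz).
- by have := step1_good gx gz' (covers_lt c1') e2'; rewrite (covers_wedge xz w xz').
- by have := step2_good gx gz' e1' (covers_lt c2'); rewrite (covers_wedge xz w xz').
- rewrite (lam_step12 r gx gz w c1 c2) (lam_step12 r gx gz' w' c1' c2') !(wo_ww wo).
  have [e1|n1] := eqVneq z'.1 z.1; last first.
    by case/andP: (first1 c1 c1' n1) => -> /negbTE->.
  have [[rf _ _] _] := CL1; rewrite e1 rf /=; apply: first2 => //.
  by apply: contra nz => /eqP e2; apply/eqP/prod_eqP.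
Qed.

Lemma increasing_lex_first r x p p' : good k x -> rooted r x ->
  path (covers Q) x p -> path (covers Q) x p' -> last x p = last x p' ->
  sorted le (label_word lam r (x :: p)) ->
  lexle le (label_word lam r (x :: p)) (label_word lam r (x :: p')).
Proof.
elim: p x r p' => [//|z p IH] x r [|z' p'] gx mr xp xp' lp sp.
  case/andP: xp => /covers_lt xz /path_covers_lt/path_lt_last/(_ z (mem_head _ _)).
  by move: lp => /= -> zx; move: (lt_le_trans xz zx); rewrite ltxx.
have /andP[xz zp] := xp; have /andP[xz' zp'] := xp'.
have [e|nz] := eqVneq z z'.
  rewrite -{z'}e in xp' xz' zp' lp *; have [rf _ _] := wo_order wo.
  have [_ gz] := covers_good xz.
  rewrite !label_word_cons [lexle _ _ _]/= rf /=; apply: IH => //.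
    exact: rooted_step xz.
  by move: sp => /path_sorted.
have zl : (z' <= last z p)%O.
  move: lp => /= ->; apply: (path_lt_last (path_covers_lt zp')); exact: mem_head.
rewrite !label_word_cons [lexle _ _ _]/=.
by case/andP: (first_label mr xp erefl sp xz' zl nz) => -> /negbTE->.
Qed.

Theorem CL_product : CL_labeling Q le lam.
Proof.
apply: CL_of_paths; first exact: wo_order wo.
move=> x y r xQ yQ lexy mr; have gx := xQ; have gy := yQ.
rewrite !in_Q in gx gy; move: lexy; rewrite leEprod => /andP[xy1 xy2].
have r1 := rooted_proj1 gx mr; have r2 := rooted_proj2 gx mr.
have [p1 [P1 E1 S1 U1]] := CL_pathE CL1 (in1 _) (in1 _) xy1 r1.
have [p2 [P2 E2 S2 U2]] := CL_pathE CL2 (in2 _) (in2 _) xy2 r2.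
have [p [xp e1 e2 sp]] := merge_exists gx gy mr P1 E1 P2 E2 S1 S2.
have lp : last x p = y.
  apply: prod_eqP.
  - by rewrite -E1 -e1 (last_proj_path (fun z : T => z.1 : T1)).
  - by rewrite -E2 -e2 (last_proj_path (fun z : T => z.2 : T2)).
exists p; split=> // p' xp' lp'; split; last first.
  by apply: increasing_lex_first; rewrite ?lp.
move=> sp'; have [S1' S2'] := increasing_proj xp' mr sp'.
apply: (merge_unique (wo_cross_transitive wo) (wo_cross_asymmetric wo) xp' xp mr sp' sp).
- have P := proj_pathP (@covers_pp_proj1 _ _ _ _ k _ _) xp'.
  have l : last x.1 (proj1 x p') = y.1.
    by rewrite (last_proj_path (fun z : T => z.1 : T1)) lp'.
  by rewrite e1; exact: (U1 _ P l).1 S1'.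
- have P := proj_pathP (@covers_pp_proj2 _ _ _ _ k _ _) xp'.
  have l : last x.2 (proj2 x p') = y.2.
    by rewrite (last_proj_path (fun z : T => z.2 : T2)) lp'.
  by rewrite e2; exact: (U2 _ P l).1 S2'.
Qed.

(** Uniqueness in a factor is assumed only for the projections of [c] and [c'], since a factor
    provides it only for faces of one complex. *)
Theorem descending_chain_unique r x y c c' :
  x \in Q -> y \in Q -> (x <= y)%O -> rooted r x ->
  maxchain (itv Q x y) c -> descending le (labels lam r c) ->
  maxchain (itv Q x y) c' -> descending le (labels lam r c') ->
  (forall c1 c1', maxchain (itv [set: T1] x.1 y.1) c1 ->
     descending le1 (labels lam1 (proj1_chain r) c1) ->
     maxchain (itv [set: T1] x.1 y.1) c1' ->
     descending le1 (labels lam1 (proj1_chain r) c1') ->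
     c1 = proj1_chain c -> c1' = proj1_chain c' -> c1 = c1') ->
  (forall c2 c2', maxchain (itv [set: T2] x.2 y.2) c2 ->
     descending le2 (labels lam2 (proj2_chain r) c2) ->
     maxchain (itv [set: T2] x.2 y.2) c2' ->
     descending le2 (labels lam2 (proj2_chain r) c2') ->
     c2 = proj2_chain c -> c2' = proj2_chain c' -> c2 = c2') ->
  c = c'.
Proof.
move=> xQ yQ xy mr mc dc mc' dc' H1 H2.
have m1 : maxchain (itv [set: T1] x.1 y.1) (proj1_chain c) :=
  maxchain_proj (@covers_pp_proj1 _ _ _ _ k _ _) xQ yQ xy (in1 _) mc.
have m2 : maxchain (itv [set: T2] x.2 y.2) (proj2_chain c) :=
  maxchain_proj (@covers_pp_proj2 _ _ _ _ k _ _) xQ yQ xy (in2 _) mc.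
have m1' : maxchain (itv [set: T1] x.1 y.1) (proj1_chain c') :=
  maxchain_proj (@covers_pp_proj1 _ _ _ _ k _ _) xQ yQ xy (in1 _) mc'.
have m2' : maxchain (itv [set: T2] x.2 y.2) (proj2_chain c') :=
  maxchain_proj (@covers_pp_proj2 _ _ _ _ k _ _) xQ yQ xy (in2 _) mc'.
have [p [xp lp cE]] := maxchain_itv_path xQ yQ xy mc.
have [p' [xp' lp' cE']] := maxchain_itv_path xQ yQ xy mc'.
rewrite cE cE' in dc dc' m1 m2 m1' m2' H1 H2 *.
have iE1 q : proj1_chain [set z in x :: q] = [set z in x.1 :: proj1 x q].
  exact: (imset_proj_path (fun z : T => z.1 : T1)).
have iE2 q : proj2_chain [set z in x :: q] = [set z in x.2 :: proj2 x q].
  exact: (imset_proj_path (fun z : T => z.2 : T2)).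
have P1 := proj_pathP (@covers_pp_proj1 _ _ _ _ k _ _) xp.
have P2 := proj_pathP (@covers_pp_proj2 _ _ _ _ k _ _) xp.
have P1' := proj_pathP (@covers_pp_proj1 _ _ _ _ k _ _) xp'.
have P2' := proj_pathP (@covers_pp_proj2 _ _ _ _ k _ _) xp'.
rewrite (labels_path _ _ xp) in dc; rewrite (labels_path _ _ xp') in dc'.
have [D1 D2] := descending_proj xp mr dc.
have [D1' D2'] := descending_proj xp' mr dc'.
suff -> : p = p' by [].
apply: (merge_unique (wo_cross_transitive_desc wo) (wo_cross_asymmetric_desc wo) xp xp' mr dc dc').
- apply: set_path_inj (path_covers_lt P1) (path_covers_lt P1') _.
  rewrite -!iE1; apply: H1 m1 _ m1' _ erefl erefl.
  + by rewrite iE1 (labels_path _ _ P1).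
  + by rewrite iE1 (labels_path _ _ P1').
- apply: set_path_inj (path_covers_lt P2) (path_covers_lt P2') _.
  rewrite -!iE2; apply: H2 m2 _ m2' _ erefl erefl.
  + by rewrite iE2 (labels_path _ _ P2).
  + by rewrite iE2 (labels_path _ _ P2').
Qed.

End ProductPaths.

From mathcomp Require Import ring lra boolp classical_sets reals.

(** * Polytope faces as sets of generating points *)

Section FaceIndices.
Local Open Scope ring_scope.
Context {R : realType}.
Implicit Types (e n : nat).

Definition dot e (x : 'rV[R]_e) (u : 'cV[R]_e) : R := (x *m u) 0 0.

Lemma dot0 e (x : 'rV[R]_e) : dot x 0 = 0.
Proof. by rewrite /dot mulmx0 mxE. Qed.

Lemma dot_row_col e1 e2 (x1 : 'rV[R]_e1) (x2 : 'rV[R]_e2) u1 u2 :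
  dot (row_mx x1 x2) (col_mx u1 u2) = dot x1 u1 + dot x2 u2.
Proof. by rewrite /dot mul_row_col mxE. Qed.

Lemma dot0l e (u : 'cV[R]_e) : dot 0 u = 0.
Proof. by rewrite /dot mul0mx mxE. Qed.

Lemma dot1 (t : R) : dot 1%:M t%:M = t.
Proof. by rewrite /dot mul1mx mxE eqxx. Qed.

Lemma dotBl e (x y : 'rV[R]_e) u : dot (x - y) u = dot x u - dot y u.
Proof. by rewrite /dot mulmxBl !mxE. Qed.

Lemma dotZr e (x : 'rV[R]_e) a u : dot x (a *: u) = a * dot x u.
Proof. by rewrite /dot -scalemxAr mxE. Qed.

Lemma dotZl e (x : 'rV[R]_e) a u : dot (a *: x) u = a * dot x u.
Proof. by rewrite /dot -scalemxAl mxE. Qed.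

Lemma dot_suml e (I : finType) (x : I -> 'rV[R]_e) u :
  dot (\sum_i x i) u = \sum_i dot (x i) u.
Proof. by rewrite /dot mulmx_suml summxE. Qed.

(* J is the vertex set of a face; faces are encoded by such sets below. *)
Definition face_idx e (I : finType) (v : I -> 'rV[R]_e) (J : {set I}) : Prop :=
  exists (u : 'cV[R]_e) (b : R),
    forall i, dot (v i) u <= b /\ (i \in J <-> dot (v i) u = b).

(** A combinatorial form of [polytope_face_lattice]. The index type is an arbitrary finite type, so
    that sums and products of index types can serve the products of polytopes. *)
Definition idx_lattice {d : Order.disp_t} {T : finPOrderType d} (A : {set T})
    e (I : finType) (v : I -> 'rV[R]_e) (J : T -> {set I}) : Prop :=
  [/\ {in A, forall x, face_idx v (J x)},
      forall K, face_idx v K -> exists2 x, x \in A & J x = K &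
      {in A &, forall x y, (x <= y)%O <-> J x \subset J y}].

Lemma conv_dot_le e n (v : 'I_n -> 'rV[R]_e) u b (w : 'I_n -> R) :
  (forall i, dot (v i) u <= b) -> (forall i, 0 <= w i) -> \sum_i w i = 1 ->
  dot (\sum_i w i *: v i) u <= b.
Proof.
move=> h w0 w1; rewrite dot_suml -[b]mul1r -w1 mulr_suml.
by apply: ler_sum => i _; rewrite dotZl ler_wpM2l.
Qed.

(** The gap to [b] is a nonnegative combination of the gaps at the points, so it vanishes only if
    every point with a positive gap has weight 0. *)
Lemma conv_dot_eq e n (v : 'I_n -> 'rV[R]_e) u b (w : 'I_n -> R) :
  (forall i, dot (v i) u <= b) -> (forall i, 0 <= w i) -> \sum_i w i = 1 ->
  dot (\sum_i w i *: v i) u = b <-> (forall i, dot (v i) u <> b -> w i = 0).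
Proof.
move=> h w0 w1; have -> : dot (\sum_i w i *: v i) u = b - \sum_i w i * (b - dot (v i) u).
  have bE : b = \sum_i w i * b by rewrite -mulr_suml w1 mul1r.
  rewrite dot_suml {1}bE -sumrB.
  by apply: eq_bigr => i _; rewrite dotZl; ring.
split=> [e0 i ni|h0].
  have s0 : \sum_i w i * (b - dot (v i) u) = 0 by lra.
  have ge0 j : true -> 0 <= w j * (b - dot (v j) u).
    by move=> _; rewrite mulr_ge0 // subr_ge0.
  have /eqP := psumr_eq0P ge0 s0 (i := i) isT.
  by rewrite mulf_eq0 subr_eq0 => /orP[/eqP//|/eqP/esym].
rewrite big1 ?subr0 // => i _; have [->|/h0->] := pselect (dot (v i) u = b).
- by rewrite subrr mulr0.
- by rewrite mul0r.
Qed.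

Lemma conv_vertex e n (v : 'I_n -> 'rV[R]_e) i : conv v (v i).
Proof.
exists (fun j => (j == i)%:R); split.
- by move=> j; rewrite ler0n.
- by rewrite (bigD1 i) //= eqxx big1 ?addr0 // => j /negbTE->.
- rewrite (bigD1 i) //= eqxx scale1r big1 ?addr0 // => j /negbTE->.
  by rewrite scale0r.
Qed.

Section Lattice.
Context {d : Order.disp_t} {T : finPOrderType d}.
Implicit Types A : {set T}.

Lemma idx_lattice_of_faces A : polytope_face_lattice R A ->
  exists e n (v : 'I_n -> 'rV[R]_e) (J : T -> {set 'I_n}), idx_lattice A v J.
Proof.
move=> [e [n [v [f [fA fs fo]]]]]; exists e, n, v.
exists (fun x => [set i | `[< f x (v i) >]]).
have inJ x i : i \in [set i | `[< f x (v i) >]] <-> f x (v i).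
  by rewrite inE; split=> [/asboolP|h] //; exact/asboolP.
split.
- move=> x xA; have [u [b [le fE]]] := fA x xA.
  exists u, b => i; split; first by apply: le; exact: conv_vertex.
  rewrite inJ fE /=; split=> [[]//|h]; split=> //; exact: conv_vertex.
- move=> K [u [b h]].
  have [|x xA fx] := fs [set z | conv v z /\ dot z u = b]%classic.
    exists u, b; split=> // z [w [w0 w1 ->]].
    by apply: conv_dot_le => // i; case: (h i).
  exists x => //; apply/setP => i; apply/idP/idP => [/inJ|iK].
  - by rewrite fx /= => -[_ ?]; apply/(h i).2.
  - by apply/inJ; rewrite fx; split; [exact: conv_vertex|apply/(h i).2].
- move=> x y xA yA; rewrite fo //; split=> [s|/fintype.subsetP s].
    by apply/fintype.subsetP => i /inJ/s/inJ.
  (* A point of [f x] has its weights supported on the generators in [f x], which all lie in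
     [f y]. *)
  have [u [b [le fE]]] := fA x xA; have [u' [b' [le' fE']]] := fA y yA.
  rewrite fE => z [zv zb]; rewrite fE'; split=> //.
  have [w [w0 w1 ez]] := zv; rewrite ez.
  have lev i : dot (v i) u <= b by apply: le; exact: conv_vertex.
  apply/(conv_dot_eq _ w0 w1) => [i|i ni]; first by apply: le'; exact: conv_vertex.
  have /(conv_dot_eq lev w0 w1) : dot (\sum_i w i *: v i) u = b by rewrite -ez.
  apply=> ei; apply: ni.
  have /s/inJ : i \in [set i | `[< f x (v i) >]].
    by apply/inJ; rewrite fE; split=> //; exact: conv_vertex.
  by rewrite fE' => -[].
Qed.

Lemma faces_of_idx_lattice A e (I : finType) (v : I -> 'rV[R]_e) (J : T -> {set I}) :
  idx_lattice A v J -> polytope_face_lattice R A.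
Proof.
move=> [JA Js Jo]; pose v' (i : 'I_#|I|) := v (enum_val i).
(* The face is recovered as the hull of its generating points. *)
pose f x : set 'rV[R]_e := [set z | exists w : 'I_#|I| -> R,
   [/\ forall i, 0 <= w i, \sum_i w i = 1, forall i, enum_val i \notin J x -> w i = 0 &
       z = \sum_i w i *: v' i]]%classic.
have fE x u b : (forall i, dot (v i) u <= b /\ (i \in J x <-> dot (v i) u = b)) ->
    f x = [set z | conv v' z /\ dot z u = b]%classic.
  move=> h; have h' i : dot (v' i) u <= b by case: (h (enum_val i)).
  apply/seteqP; split=> [z [w [w0 w1 wJ ->]]|z [[w [w0 w1 ->]] zb]].
  - split; first by exists w.
    apply/(conv_dot_eq h' w0 w1) => i ni; apply: wJ; apply/negP => iJ.
    by apply: ni; apply/(h (enum_val i)).2.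
  - exists w; split=> // i iJ; apply: ((conv_dot_eq h' w0 w1).1 zb) => ei.
    by move/negP: iJ; apply; apply/(h (enum_val i)).2.
have valid x u b : (forall i, dot (v i) u <= b /\ (i \in J x <-> dot (v i) u = b)) ->
    forall z, conv v' z -> dot z u <= b.
  move=> h z [w [w0 w1 ->]].
  by apply: conv_dot_le => // i; case: (h (enum_val i)).
have fv x i : x \in A -> f x (v i) <-> i \in J x.
  move=> xA; have [u [b h]] := JA x xA; rewrite (fE x u b h) /= (h i).2.
  split=> [[]//|ei]; split=> //; rewrite -[i]enum_rankK; exact: (conv_vertex v').
exists e, #|I|, v', f; split.
- move=> x xA; have [u [b h]] := JA x xA; exists u, b; split; first exact: valid h.
  exact: fE h.
- move=> F [u [b [le ->]]].
  pose K := [set i | dot (v i) u == b].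
  have hK i : dot (v i) u <= b /\ (i \in K <-> dot (v i) u = b).
    split; last by rewrite inE; split=> [/eqP|->].
    rewrite -[i]enum_rankK; apply: le; exact: (conv_vertex v').
  have [|x xA JxK] := Js K; first by exists u, b.
  by exists x => //; apply: fE; rewrite JxK.
- move=> x y xA yA; rewrite Jo //; split=> [/fintype.subsetP s|s].
    move=> z [w [w0 w1 wJ ->]]; exists w; split=> // i ni; apply: wJ.
    by apply: contra ni => /s.
  by apply/fintype.subsetP => i /(fv x i xA)/s/(fv y i yA).
Qed.

(** Translating the mean of the points to the origin shifts each bound [b] and leaves the index sets
    of faces unchanged. For [n = 0] the sums are empty. *)
Lemma idx_lattice_centered A e n (v : 'I_n -> 'rV[R]_e) J : idx_lattice A v J ->
  exists v' : 'I_n -> 'rV[R]_e, \sum_i v' i = 0 /\ idx_lattice A v' J.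
Proof.
pose c := n%:R^-1 *: \sum_i v i.
move=> H; exists (fun i => v i - c); split.
  rewrite sumrB sumr_const card_ord /c -scaler_nat scalerA.
  have [n0|n0] := posnP n; last by rewrite mulfV ?pnatr_eq0 ?gtn_eqF // scale1r subrr.
  rewrite [\sum_i v i]big1 ?scaler0 ?subrr // => i _.
  by have := ltn_ord i; rewrite [X in (_ < X)%N]n0.
have idxE K : face_idx (fun i => v i - c) K <-> face_idx v K.
  split=> -[u [b h]].
  - exists u, (b + dot c u) => i; have := h i; rewrite dotBl => -[h1 ->].
    split; first lra.
    by split=> ?; lra.
  - exists u, (b - dot c u) => i; have [h1 ->] := h i; rewrite dotBl.
    split; first lra.
    by split=> ?; lra.
case: H => H1 H2 H3; split=> // [x xA|K /idxE]; last exact: H2.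
by apply/idxE; exact: H1.
Qed.

End Lattice.

End FaceIndices.

(** * Face lattices of the join, the product and the direct sum *)

Section ProductLattices.
Local Open Scope ring_scope.
Context {R : realType}.
Context {d1 d2 : Order.disp_t} {T1 : finTBPOrderType d1} {T2 : finTBPOrderType d2}.
Notation T := (T1 *p T2).
Variables (A1 : {set T1}) (A2 : {set T2}).
Variables (e1 e2 n1 n2 : nat) (v1 : 'I_n1 -> 'rV[R]_e1) (v2 : 'I_n2 -> 'rV[R]_e2).
Variables (J1 : T1 -> {set 'I_n1}) (J2 : T2 -> {set 'I_n2}).
Hypotheses (H1 : idx_lattice A1 v1 J1) (H2 : idx_lattice A2 v2 J2).

Definition sum_idx (z : T) : {set 'I_n1 + 'I_n2} :=
  [set s | match s with inl i => i \in J1 z.1 | inr j => j \in J2 z.2 end].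

Lemma sum_idxS (z z' : T) :
  (sum_idx z \subset sum_idx z') = (J1 z.1 \subset J1 z'.1) && (J2 z.2 \subset J2 z'.2).
Proof.
apply/idP/andP => [/fintype.subsetP s|[/fintype.subsetP s1 /fintype.subsetP s2]].
  split; apply/fintype.subsetP => i.
  - by have := s (inl i); rewrite !inE.
  - by have := s (inr i); rewrite !inE.
by apply/fintype.subsetP => -[i|j]; rewrite !inE; [exact: s1|exact: s2].
Qed.

Lemma sum_idx_mono k : {in pp k A1 A2 &, forall z z' : T,
  (z <= z')%O <-> sum_idx z \subset sum_idx z'}.
Proof.
case: H1 => _ _ o1; case: H2 => _ _ o2 z z'; rewrite !in_pp.
move=> /and3P[z1 z2 _] /and3P[z1' z2' _]; rewrite sum_idxS leEprod.
by split=> /andP[/(o1 _ _ z1 z1') -> /(o2 _ _ z2 z2') ->].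
Qed.

Lemma polytope_join : polytope_face_lattice R (pp PX A1 A2).
Proof.
case: (H1) => F1 S1 _; case: (H2) => F2 S2 _.
(* The extra coordinate puts the polytopes at heights 1 and 0, in skew affine subspaces. *)
pose v (s : 'I_n1 + 'I_n2) : 'rV[R]_(e1 + (e2 + 1)) :=
  match s with
  | inl i => row_mx (v1 i) (row_mx 0 1%:M)
  | inr j => row_mx 0 (row_mx (v2 j) 0)
  end.
have vE s u1 u2 t : dot (v s) (col_mx u1 (col_mx u2 t%:M)) =
    match s with inl i => dot (v1 i) u1 + t | inr j => dot (v2 j) u2 end.
  by case: s => i; rewrite /v !dot_row_col !dot0l ?dot1 ?add0r ?addr0.
apply: (@faces_of_idx_lattice _ _ _ _ _ _ v sum_idx); split.
- move=> z; rewrite in_pp => /and3P[/F1[u1 [b1 h1]] /F2[u2 [b2 h2]] _].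
  (* The height coefficient [b2 - b1] raises the bound on the first polytope to that on the second,
     so any pair of faces can be cut out together. *)
  exists (col_mx u1 (col_mx u2 (b2 - b1)%:M)), b2 => -[i|j]; rewrite vE inE.
  + have [h ->] := h1 i; split; first lra.
    by split=> ?; lra.
  + exact: h2.
- move=> K [u [b]]; rewrite -[u]vsubmxK -[dsubmx u]vsubmxK.
  move: (usubmx u) (usubmx (dsubmx u)) => u1 u2.
  rewrite [dsubmx (dsubmx u)]mx11_scalar; move: (dsubmx (dsubmx u) 0 0) => t h.
  pose K1 := [set i | inl i \in K]; pose K2 := [set j | inr j \in K].
  have [|x1 x1A e1'] := S1 K1.
    exists u1, (b - t) => i; have := h (inl i); rewrite vE inE => -[h' ->].
    split; first lra.
    by split=> ?; lra.
  have [|x2 x2A e2'] := S2 K2.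
    by exists u2, b => j; have := h (inr j); rewrite vE inE.
  exists ((x1, x2) : T); first by rewrite in_pp x1A x2A.
  by apply/setP => -[i|j]; rewrite inE /= (e1', e2') inE.
- exact: sum_idx_mono.
Qed.

Hypotheses (b1 : \bot%O \in A1) (t1 : \top%O \in A1).
Hypotheses (b2 : \bot%O \in A2) (t2 : \top%O \in A2).

Lemma idx_lattice_bot {d} {P : finTBPOrderType d} (A : {set P}) e n
    (v : 'I_n -> 'rV[R]_e) J : idx_lattice A v J -> \bot%O \in A ->
  J \bot%O = finset.set0 /\ {in A, forall x, J x = finset.set0 -> x = \bot%O}.
Proof.
move=> [F S o] bA.
have [|x xA Jx] := S finset.set0.
  (* The zero functional with bound 1 cuts out the empty face. *)
  exists 0, 1 => i; rewrite dot0 inE; split; first exact: ler01.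
  by split=> // /eqP; rewrite eq_sym oner_eq0.
have J0 : J \bot%O = finset.set0.
  by apply/eqP; rewrite -finset.subset0 -Jx; apply/o => //; exact: le0x.
split=> // y yA Jy; apply/eqP; rewrite -lex0; apply/o => //.
by rewrite Jy finset.sub0set.
Qed.

Lemma idx_lattice_top {d} {P : finTBPOrderType d} (A : {set P}) e n
    (v : 'I_n -> 'rV[R]_e) J : idx_lattice A v J -> \top%O \in A ->
  J \top%O = finset.setT /\ {in A, forall x, J x = finset.setT -> x = \top%O}.
Proof.
move=> [F S o] bA.
have [|x xA Jx] := S finset.setT.
  by exists 0, 0 => i; rewrite dot0 inE.
have J0 : J \top%O = finset.setT.
  by apply/eqP; rewrite -finset.subTset -Jx; apply/o => //; exact: lex1.
split=> // y yA Jy; apply/eqP; rewrite -le1x; apply/o => //.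
by rewrite Jy finset.subsetT.
Qed.

Lemma polytope_product : polytope_face_lattice R (pp PC A1 A2).
Proof.
case: (H1) => F1 S1 o1; case: (H2) => F2 S2 o2.
have [B1 C1] := idx_lattice_bot H1 b1; have [B2 C2] := idx_lattice_bot H2 b2.
pose v (s : 'I_n1 * 'I_n2) : 'rV[R]_(e1 + e2) := row_mx (v1 s.1) (v2 s.2).
(* A product of index sets is empty as soon as one factor is, which is why the check product keeps a
   single bottom. *)
pose J (z : T) := finset.setX (J1 z.1) (J2 z.2).
have bot_in : ((\bot, \bot)%O : T) \in pp PC A1 A2 by rewrite in_pp b1 b2 /= !eqxx.
apply: (@faces_of_idx_lattice _ _ _ _ _ _ v J); split.
- move=> z; rewrite in_pp => /and3P[/F1[u1 [c1 h1]] /F2[u2 [c2 h2]] _].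
  exists (col_mx u1 u2), (c1 + c2) => -[i j]; rewrite dot_row_col inE /=.
  have [k1 m1] := h1 i; have [k2 m2] := h2 j.
  split; first lra.
  split=> [/andP[/m1-> /m2->] //|s]; apply/andP; split.
  + by apply/m1; lra.
  + by apply/m2; lra.
- move=> K [u [b]]; rewrite -[u]vsubmxK; move: (usubmx u) (dsubmx u) => u1 u2 h.
  have [->|[[i0 j0] K0]] := set_0Vmem K.
    by exists ((\bot, \bot)%O : T) => //; rewrite /J /= B1; apply/setP => -[i j]; rewrite !inE.
  have hd i j : dot (v1 i) u1 + dot (v2 j) u2 <= b.
    by have [] := h (i, j); rewrite dot_row_col.
  have hK i j : (i, j) \in K <-> dot (v1 i) u1 + dot (v2 j) u2 = b.
    by have [_] := h (i, j); rewrite dot_row_col.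
  have E0 := (hK _ _).1 K0.
  (* At a point [(i0, j0)] of the face the sum is maximal, so each summand is maximal over its own
     factor; the face is the product of the two sets of maximizers. *)
  have [|x1 x1A E1] := S1 [set i | dot (v1 i) u1 == dot (v1 i0) u1].
    exists u1, (dot (v1 i0) u1) => i; split; first by have := hd i j0; lra.
    by rewrite inE; split=> [/eqP|/eqP].
  have [|x2 x2A E2] := S2 [set j | dot (v2 j) u2 == dot (v2 j0) u2].
    exists u2, (dot (v2 j0) u2) => j; split; first by have := hd i0 j; lra.
    by rewrite inE; split=> [/eqP|/eqP].
  have n1x : x1 != \bot%O.
    apply/eqP => ex; move: E1; rewrite ex B1 => /setP/(_ i0).
    by rewrite !inE eqxx.
  have n2x : x2 != \bot%O.
    apply/eqP => ex; move: E2; rewrite ex B2 => /setP/(_ j0).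
    by rewrite !inE eqxx.
  exists ((x1, x2) : T).
    by rewrite in_pp x1A x2A /= (negbTE n1x) (negbTE n2x).
  apply/setP => -[i j]; rewrite inE /= E1 E2 !inE.
  apply/andP/idP => [[/eqP ei /eqP ej]|/hK eij]; first by apply/hK; lra.
  have := hd i j0; have := hd i0 j => ? ?.
  by split; apply/eqP; lra.
- move=> z z'; rewrite !in_pp => /and3P[z1 z2 /eqP gz] /and3P[z1' z2' _].
  rewrite leEprod; split=> [/andP[/(o1 _ _ z1 z1') s1 /(o2 _ _ z2 z2') s2]|/fintype.subsetP s].
    by apply: finset.setXS.
  (* A product set determines its factors only if both are nonempty; goodness ensures this away from
     the bottom. *)
  have [e|n] := eqVneq z.1 \bot%O.
    by move: gz; rewrite e eqxx => /esym/eqP->; rewrite !le0x.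
  have n' : z.2 != \bot%O by rewrite -gz (negbTE n).
  have [f|[i iJ]] := set_0Vmem (J1 z.1); first by rewrite (C1 _ z1 f) eqxx in n.
  have [f|[j jJ]] := set_0Vmem (J2 z.2); first by rewrite (C2 _ z2 f) eqxx in n'.
  apply/andP; split.
  + apply/(o1 _ _ z1 z1')/fintype.subsetP => i' iJ'.
    by have := s (i', j); rewrite !inE iJ' jJ => /(_ isT)/andP[].
  + apply/(o2 _ _ z2 z2')/fintype.subsetP => j' jJ'.
    by have := s (i, j'); rewrite !inE iJ jJ' => /(_ isT)/andP[].
Qed.

(** The values of [u] at the points sum to 0, so a bound [b <= 0] makes all of them vanish and the
    face is everything. *)
Lemma centered_face_gt0 e n (v : 'I_n -> 'rV[R]_e) (u : 'cV[R]_e) b (K : {set 'I_n}) :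
  \sum_i v i = 0 -> K != finset.setT ->
  (forall i, dot (v i) u <= b /\ (i \in K <-> dot (v i) u = b)) -> 0 < b.
Proof.
move=> v0 KT h; rewrite ltNge; apply/negP => b0.
have /fintype.subsetPn[i _ iK] : ~~ (finset.setT \subset K) by rewrite finset.subTset.
have s0 : \sum_i - dot (v i) u = 0 by rewrite sumrN -dot_suml v0 dot0l oppr0.
have g0 j : true -> 0 <= - dot (v j) u by have := (h j).1; lra.
have d0 := psumr_eq0P g0 s0 (i := i) isT.
by move/negP: iK; apply; apply/(h i).2; have := (h i).1; lra.
Qed.

(** The values sum to [n * b] and to 0; the index [i0] only witnesses that [n] is nonzero. *)
Lemma centered_face_top e n (v : 'I_n -> 'rV[R]_e) (u : 'cV[R]_e) (b : R) (i0 : 'I_n) :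
  \sum_i v i = 0 -> (forall i, dot (v i) u = b) -> b = 0.
Proof.
move=> v0 h; have : \sum_i dot (v i) u = 0 by rewrite -dot_suml v0 dot0l.
rewrite (eq_bigr (fun=> b)) // sumr_const card_ord => /eqP.
rewrite mulrn_eq0 => /orP[/eqP n0|/eqP//].
by have := ltn_ord i0; rewrite [X in (_ < X)%N]n0.
Qed.

Lemma centered_face0 e n (v : 'I_n -> 'rV[R]_e) (u : 'cV[R]_e) (i : 'I_n) :
  \sum_i v i = 0 -> (forall i, dot (v i) u <= 0) -> dot (v i) u = 0.
Proof.
move=> v0 h; have s0 : \sum_i - dot (v i) u = 0 by rewrite sumrN -dot_suml v0 dot0l oppr0.
have g0 j : true -> 0 <= - dot (v j) u by have := h j; lra.
by have := psumr_eq0P g0 s0 (i := i) isT; lra.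
Qed.

Hypotheses (nd1 : \bot%O != \top%O :> T1) (nd2 : \bot%O != \top%O :> T2).
Hypotheses (c1 : \sum_i v1 i = 0) (c2 : \sum_j v2 j = 0).

(* The origin is interior to both polytopes, so a proper face is cut out by an
   inequality with b > 0, which can be scaled to b = 1. *)
Lemma polytope_direct_sum : polytope_face_lattice R (pp PH A1 A2).
Proof.
case: (H1) => F1 S1 o1; case: (H2) => F2 S2 o2.
have [B1 _] := idx_lattice_bot H1 b1; have [B2 _] := idx_lattice_bot H2 b2.
have [D1 C1] := idx_lattice_top H1 t1; have [D2 C2] := idx_lattice_top H2 t2.
have inh1 : exists i0 : 'I_n1, true.
  have [e|[i _]] := set_0Vmem (finset.setT : {set 'I_n1}); last by exists i.
  by case/eqP: nd1; apply: C1; rewrite // B1 e.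
have inh2 : exists j0 : 'I_n2, true.
  have [e|[i _]] := set_0Vmem (finset.setT : {set 'I_n2}); last by exists i.
  by case/eqP: nd2; apply: C2; rewrite // B2 e.
have [i0 _] := inh1; have [j0 _] := inh2.
pose v (s : 'I_n1 + 'I_n2) : 'rV[R]_(e1 + e2) :=
  match s with inl i => row_mx (v1 i) 0 | inr j => row_mx 0 (v2 j) end.
have vE s u1 u2 : dot (v s) (col_mx u1 u2) =
    match s with inl i => dot (v1 i) u1 | inr j => dot (v2 j) u2 end.
  by case: s => i; rewrite /v !dot_row_col !dot0l ?add0r ?addr0.
apply: (@faces_of_idx_lattice _ _ _ _ _ _ v sum_idx); split.
- move=> z; rewrite in_pp => /and3P[z1 z2 /eqP gz].
  have [e|n] := eqVneq z.1 \top%O.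
    move: gz; rewrite e eqxx => /esym/eqP e'; exists 0, 0 => s; rewrite dot0.
    by split=> //; split=> // _; rewrite inE e e' D1 D2; case: s => ?; rewrite inE.
  have n' : z.2 != \top%O by rewrite -gz (negbTE n).
  have [u1 [r1 h1]] := F1 _ z1; have [u2 [r2 h2]] := F2 _ z2.
  have p1 : 0 < r1.
    by apply: centered_face_gt0 c1 _ h1; apply: contra n => /eqP/(C1 _ z1)->.
  have p2 : 0 < r2.
    by apply: centered_face_gt0 c2 _ h2; apply: contra n' => /eqP/(C2 _ z2)->.
  exists (col_mx (r1^-1 *: u1) (r2^-1 *: u2)), 1 => -[i|j]; rewrite vE inE dotZr.
  + have [k1 ->] := h1 i; rewrite -[1](mulVf (lt0r_neq0 p1)).
    rewrite ler_pM2l ?invr_gt0 //; split=> //.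
    by split=> [->//|/mulfI]; apply; rewrite invr_eq0 gt_eqF.
  + have [k2 ->] := h2 j; rewrite -[1](mulVf (lt0r_neq0 p2)).
    rewrite ler_pM2l ?invr_gt0 //; split=> //.
    by split=> [->//|/mulfI]; apply; rewrite invr_eq0 gt_eqF.
- move=> K [u [b]]; rewrite -[u]vsubmxK; move: (usubmx u) (dsubmx u) => u1 u2 h.
  have h1 i : dot (v1 i) u1 <= b /\ (inl i \in K <-> dot (v1 i) u1 = b).
    by have := h (inl i); rewrite vE.
  have h2 j : dot (v2 j) u2 <= b /\ (inr j \in K <-> dot (v2 j) u2 = b).
    by have := h (inr j); rewrite vE.
  have [|x1 x1A E1] := S1 [set i | inl i \in K].
    by exists u1, b => i; rewrite inE.
  have [|x2 x2A E2] := S2 [set j | inr j \in K].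
    by exists u2, b => j; rewrite inE.
  exists ((x1, x2) : T); last by apply/setP => -[i|j]; rewrite inE /= (E1, E2) inE.
  rewrite in_pp x1A x2A /=; apply/eqP; apply/idP/idP => /eqP e; apply/eqP.
  (* If one factor contributes its whole polytope, centering gives [b = 0]; the other functional is
     then nonpositive with sum 0, so it vanishes too. Hence the tops are reached together. *)
  + have full i : dot (v1 i) u1 = b.
      apply/(h1 i).2; move: E1; rewrite e D1 => /setP/(_ i).
      by rewrite !inE => <-.
    have b0 := centered_face_top i0 c1 full; rewrite b0 in h2.
    apply: C2 => //; rewrite E2; apply/setP => j; rewrite !inE; apply/(h2 j).2.
    by apply: centered_face0 c2 _ => j'; case: (h2 j').
  + have full j : dot (v2 j) u2 = b.
      apply/(h2 j).2; move: E2; rewrite e D2 => /setP/(_ j).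
      by rewrite !inE => <-.
    have b0 := centered_face_top j0 c2 full; rewrite b0 in h1.
    apply: C1 => //; rewrite E1; apply/setP => i; rewrite !inE; apply/(h1 i).2.
    by apply: centered_face0 c1 _ => i'; case: (h1 i').
- exact: sum_idx_mono.
Qed.

End ProductLattices.

(** * Ends of full-rank subposets *)

Section Subposets.
Context {d : Order.disp_t} {P : finTBPOrderType d}.
Implicit Types A m c : {set P}.

Lemma polytope_nonempty (R : realType) A : polytope_face_lattice R A -> exists x, x \in A.
Proof.
case/idx_lattice_of_faces => e [n [v [J [_ S _]]]].
have [|x xA _] := S finset.setT; last by exists x.
by exists 0%R, 0%R => i; rewrite dot0 inE.
Qed.

Lemma maxchain_ends A m : \bot%O \in A -> \top%O \in A -> maxchain A m ->
  \bot%O \in m /\ \top%O \in m.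
Proof.
move=> bA tA /maxchainP[_ _ mm]; split; apply: mm => // w _.
- by apply: le_comparable; exact: le0x.
- by apply: ge_comparable; exact: lex1.
Qed.

(** A maximal chain of [A] is as long as any maximal chain of [P] extending it, hence equals it and
    contains both ends. This makes the members of a CL-ced share the bottom and top of the poset, as
    gluing requires. *)
Lemma full_rank_ends A : graded [set: P] -> graded A -> rk A = rk [set: P] ->
  (exists x, x \in A) -> \bot%O \in A /\ \top%O \in A.
Proof.
move=> gP gA rA [x xA].
have cx : chain [set x].
  by apply/chainP => a b; rewrite !inE => /eqP-> /eqP->; exact: comparablexx.
have [|m mm /fintype.subsetP xm] := @maxchain_exists _ _ A [set x] cx.
  by rewrite finset.sub1set.
have xm' : x \in m by apply: xm; rewrite inE.
have /maxchainP[cm /fintype.subsetP mA _] := mm.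
have [M mM mM'] := maxchain_exists cm (finset.subsetT m).
have E : m = M.
  apply/eqP; rewrite eqEcard mM' /=.
  have := gP _ mM; rewrite -rA -(gA _ mm) /chain_length.
  have : 0 < #|m| by apply/card_gt0P; exists x.
  by case: #|m| => // a _; case: #|M| => //= b ->.
have [bM tM] := maxchain_ends (finset.in_setT _) (finset.in_setT _) mM.
by rewrite -E in bM tM; split; exact: mA.
Qed.

Lemma maxchain_of_chain m c : chain m -> maxchain m c -> c = m.
Proof.
move=> /chainP cm /maxchainP[_ /fintype.subsetP s mc]; apply/finset.setP => z.
apply/idP/idP => [/s//|zm]; apply: mc => // w /s; exact: cm.
Qed.

Lemma CLced_ends (dI : Order.disp_t) (I : finOrderType dI) (Sig : I -> {set P})
  (R : realType) L (le : rel L) (lam : labeling P L) s :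
  CLced [set: P] Sig R le lam -> \bot%O \in Sig s /\ \top%O \in Sig s.
Proof.
move=> ced; have [gs rs] := CLced_rank ced s.
apply: full_rank_ends => //; first exact: CLced_graded ced.
exact: polytope_nonempty (CLced_polytope ced s).
Qed.

End Subposets.

(** * The one-point product *)

Section SingletonPoset.
Context {d dI : Order.disp_t} {T : finPOrderType d} {I : finOrderType dI}.

Lemma CLced_singleton (q : T) (Sig : I -> {set T}) (R : realType) L (le : rel L)
    (lam : labeling T L) :
  (exists i : I, true) -> partial_order le -> (forall s, Sig s = [set q]) ->
  CLced [set q] Sig R le lam.
Proof.
move=> [i0 _] ple SE.
have no_covers x y : covers [set q] x y -> False.
  by case/coversP; rewrite !inE => /eqP-> /eqP->; rewrite ltxx.
have no_path x p : path (covers [set q]) x p -> p = [::].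
  by case: p => // y p /andP[/no_covers].
have qq : q \in [set q] by rewrite inE.
have mcE c : maxchain [set q] c -> chain_length c = 0.
  move=> /maxchainP[_ /subset_leq_card s _]; rewrite cards1 in s.
  by rewrite /chain_length; case: #|c| s => // -[].
have [gq rq] := graded_rk mcE.
split.
- by split; exists q => // x; rewrite inE => /eqP->.
- exact: gq.
- apply: CL_of_paths => // x y r; rewrite !inE => /eqP-> /eqP-> _ _.
  exists [::]; split=> // p' /no_path -> _; by [].
- by move=> s; rewrite SE.
- by move=> s; rewrite SE.
- move=> s; rewrite SE.
  (* A single point is the face lattice of the empty polytope, generated by no points. *)
  have K0 (K : {set 'I_0}) : K = finset.set0 by apply/finset.setP; case.
  apply: (@faces_of_idx_lattice R _ _ _ 0 'I_0 (fun=> 0%R) (fun=> finset.set0)); split.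
  + by move=> x _; exists 0%R, 0%R; case.
  + by move=> K _; exists q => //; rewrite (K0 K).
  + by move=> x y; rewrite !inE => /eqP-> /eqP->; rewrite lexx fintype.subxx.
- move=> s x y r c c' xq yq xy _ mc _ _ mc' _ _.
  have [p [/no_path-> _ ->]] := maxchain_itv_path xq yq xy mc.
  by have [p' [/no_path-> _ ->]] := maxchain_itv_path xq yq xy mc'.
- by move=> s r c _ _; rewrite rq ltn0.
- by move=> c _ cq; exists i0; rewrite SE.
Qed.

End SingletonPoset.

(** * Chains with prescribed projections *)

Section ProductChains.
Context {d1 d2 : Order.disp_t} {T1 : finTBPOrderType d1} {T2 : finTBPOrderType d2}.
Notation T := (T1 *p T2).
Variables (k : pkind) (A1 : {set T1}) (A2 : {set T2}).
Hypotheses (b1 : \bot%O \in A1) (t1 : \top%O \in A1).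
Hypotheses (b2 : \bot%O \in A2) (t2 : \top%O \in A2).
Hypothesis nd : nontrivial_factors (T1 := T1) (T2 := T2) k.

(** The extension is made inside the product of the two chains, where projections are maximal in a
    chain and so are all of it. An element comparable with the result has coordinates comparable
    with all of [m1] and [m2], hence in them. *)
Lemma extend_chain (c : {set T}) m1 m2 : maxchain A1 m1 -> maxchain A2 m2 ->
  chain c -> c \subset pp k m1 m2 ->
  exists m, [/\ maxchain (pp k A1 A2) m, c \subset m,
                proj1_chain m = m1 & proj2_chain m = m2].
Proof.
move=> mm1 mm2 cc cm.
have [bm1 tm1] := maxchain_ends b1 t1 mm1; have [bm2 tm2] := maxchain_ends b2 t2 mm2.
have [m mm cm'] := maxchain_exists cc cm.
have /maxchainP[c1 /fintype.subsetP s1 u1] := mm1.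
have /maxchainP[c2 /fintype.subsetP s2 u2] := mm2.
have e1 := maxchain_of_chain c1 (maxchain_pp_proj1 bm1 tm1 bm2 tm2 nd mm).
have e2 := maxchain_of_chain c2 (maxchain_pp_proj2 bm1 tm1 bm2 tm2 nd mm).
exists m; split=> //; have /maxchainP[chm /fintype.subsetP sm um] := mm.
apply/maxchainP; split=> //.
- apply/fintype.subsetP => z /sm; rewrite !in_pp => /and3P[z1 z2 ->].
  by rewrite s1 ?s2.
- move=> z; rewrite in_pp => /and3P[z1 z2 gz] cz; apply: um => //.
  rewrite in_pp gz andbT; apply/andP; split.
  + apply: u1 => // w; rewrite -e1 => /imsetP[w' /cz h ->]; move: h.
    by case/orP; rewrite leEprod => /andP[h _]; rewrite /Order.comparable h ?orbT.
  + apply: u2 => // w; rewrite -e2 => /imsetP[w' /cz h ->]; move: h.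
    by case/orP; rewrite leEprod => /andP[_ h]; rewrite /Order.comparable h ?orbT.
Qed.

End ProductChains.

(** * The decomposition of the product *)

Section ProductDecomposition.
Context {R : realType} {d1 d2 dI1 dI2 : Order.disp_t}.
Context {P1 : finTBPOrderType d1} {P2 : finTBPOrderType d2}.
Context {I1 : finOrderType dI1} {I2 : finOrderType dI2} {L1 L2 : Type}.
Notation T := (P1 *p P2).
Notation W := (wlabel L1 L2).
Variables (le1 : rel L1) (le2 : rel L2) (lam1 : labeling P1 L1) (lam2 : labeling P2 L2).
Variables (Sig1 : I1 -> {set P1}) (Sig2 : I2 -> {set P2}).
Hypothesis ced1 : CLced [set: P1] Sig1 R le1 lam1.
Hypothesis ced2 : CLced [set: P2] Sig2 R le2 lam2.
Variable k : pkind.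
Hypothesis nd : nontrivial_factors (T1 := P1) (T2 := P2) k.

Notation Q := (pp k [set: P1] [set: P2]).
Definition prod_sig (st : I1 *l I2) : {set T} := pp k (Sig1 st.1) (Sig2 st.2).

Lemma sub_prod_sig st (c : {set T}) : c \subset Q ->
  (c \subset prod_sig st) =
  (proj1_chain c \subset Sig1 st.1) && (proj2_chain c \subset Sig2 st.2).
Proof.
move=> /fintype.subsetP cQ; apply/idP/andP => [/fintype.subsetP s|[]].
  split; apply/fintype.subsetP => _ /imsetP[z /s + ->];
  by rewrite in_pp => /and3P[].
move=> /fintype.subsetP s1 /fintype.subsetP s2; apply/fintype.subsetP => z zc.
have := cQ z zc; rewrite !in_pp => /and3P[_ _ ->].
rewrite s1 ?s2 //; first by apply/imsetP; exists z.
by apply/imsetP; exists z.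
Qed.

Lemma maxchain_prod_sig_sub st m : maxchain (prod_sig st) m -> m \subset Q.
Proof.
move=> /maxchainP[_ /fintype.subsetP s _]; apply/fintype.subsetP => z /s.
by rewrite !in_pp !finset.in_setT => /and3P[_ _ ->].
Qed.

(** Pairs below [st] that change one index only already test newness of one projection, since the
    other projection lies in its own member. Conversely, a smaller pair has a smaller first index,
    or the same one and a smaller second. *)
Lemma new_chain_proj st m : maxchain (prod_sig st) m ->
  new_chain prod_sig st m =
  new_chain Sig1 st.1 (proj1_chain m) && new_chain Sig2 st.2 (proj2_chain m).
Proof.
move=> mm; have mQ := maxchain_prod_sig_sub mm.
have [b1 t1] := CLced_ends st.1 ced1; have [b2 t2] := CLced_ends st.2 ced2.
have m1 := maxchain_pp_proj1 b1 t1 b2 t2 nd mm.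
have m2 := maxchain_pp_proj2 b1 t1 b2 t2 nd mm.
have /maxchainP[_ s1 _] := m1; have /maxchainP[_ s2 _] := m2.
rewrite /new_chain mm m1 m2 /=.
apply/forallP/andP => [h|[/forallP h1 /forallP h2] r].
- split; apply/forallP => r; apply/implyP => lt.
  + have /implyP := h ((r, st.2) : I1 *l I2).
    rewrite ltEprodlexi /= (ltW lt) leNgt lt sub_prod_sig //= s2 andbT; exact.
  + have /implyP := h ((st.1, r) : I1 *l I2).
    by rewrite ltEprodlexi /= lexx lt sub_prod_sig //= s1 /=; exact.
- apply/implyP; rewrite ltEprodlexi sub_prod_sig // negb_and le_eqVlt.
  case/andP => /predU1P[-> /implyP/(_ (lexx _)) lt|lt _].
  + by apply/orP; right; move/implyP: (h2 r.2); exact.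
  + by apply/orP; left; move/implyP: (h1 r.1); exact.
Qed.

Lemma delta_face_proj st c : delta_face prod_sig st c ->
  delta_face Sig1 st.1 (proj1_chain c) /\ delta_face Sig2 st.2 (proj2_chain c).
Proof.
move=> [m nm cm]; have /andP[mm _] := nm.
move: nm; rewrite new_chain_proj // => /andP[n1 n2].
by split; [exists (proj1_chain m)|exists (proj2_chain m)] => //; exact: imsetS.
Qed.

Lemma chain_proj1 (c : {set T}) : chain c -> chain (proj1_chain c).
Proof.
move=> /chainP h; apply/chainP => _ _ /imsetP[z zc ->] /imsetP[w wc ->].
by have := h z w zc wc; case/orP; rewrite leEprod => /andP[+ _]; rewrite /Order.comparable => ->; rewrite ?orbT.
Qed.

Lemma chain_proj2 (c : {set T}) : chain c -> chain (proj2_chain c).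
Proof.
move=> /chainP h; apply/chainP => _ _ /imsetP[z zc ->] /imsetP[w wc ->].
by have := h z w zc wc; case/orP; rewrite leEprod => /andP[_ +]; rewrite /Order.comparable => ->; rewrite ?orbT.
Qed.

(* If bot |: c is already a maximal chain, it equals m and lies in m', so m is
   contained in Sig r and is not new for s. *)
Lemma boundary_extension (d dI : Order.disp_t) (P : finTBPOrderType d)
    (I : finOrderType dI) (Sig : I -> {set P}) L (le : rel L) lam s r (c : {set P}) :
  CLced [set: P] Sig R le lam -> (r < s)%O -> chain c ->
  delta_face Sig s c -> delta_face Sig r c ->
  exists m, [/\ maxchain (Sig s) m, ~~ new_chain Sig s m & c \subset m].
Proof.
move=> ced rs cc [m nm cm] [m' nm' cm'].
have /andP[mm /forallP/(_ r)] := nm; rewrite rs /= => mr.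
have /andP[mm' _] := nm'.
have [bs ts] := CLced_ends s ced; have [br tr] := CLced_ends r ced.
have [bm _] := maxchain_ends bs ts mm; have [bm' _] := maxchain_ends br tr mm'.
have sub : \bot%O |: c \subset m by rewrite finset.subUset finset.sub1set bm.
have sub' : \bot%O |: c \subset m' by rewrite finset.subUset finset.sub1set bm'.
have /maxchainP[chm _ _] := mm; have /maxchainP[_ m'r _] := mm'.
have [lt|ge] := ltnP (chain_length (\bot%O |: c)) (rk [set: P]).
  have [||m2 [M1 M2 M3]] := CLced_bdry ced rs (sub_chain sub chm) lt.
  - by exists m.
  - by exists m'.
  exists m2; split=> //; apply: fintype.subset_trans M3; exact: finset.subsetUr.
suff E : \bot%O |: c = m by move: mr; rewrite -E (fintype.subset_trans sub' m'r).
apply/eqP; rewrite eqEcard sub /=.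
have [gs rs'] := CLced_rank ced s.
move: ge; rewrite -rs' -(gs _ mm) /chain_length.
have : 0 < #|\bot%O |: c| by apply/card_gt0P; exists \bot%O; rewrite finset.setU11.
by case: #|_ |: _| => // a _; case: #|m|.
Qed.

Variables (md1 : pred L1) (md2 : pred L2) (le : rel W) (lam : labeling T W).
Hypothesis wo : word_order md1 md2 le1 le2 le.
Hypothesis special1 : forall (r : {set P1}) a b, covers [set: P1] a b ->
  maxchain (below [set: P1] a) r -> md1 (lam1 r a b) = special k a b.
Hypothesis special2 : forall (r : {set P2}) a b, covers [set: P2] a b ->
  maxchain (below [set: P2] a) r -> md2 (lam2 r a b) = special k a b.
Hypothesis lam_step1 : forall r x y, good k x -> good k y ->
  covers [set: P1] x.1 y.1 -> x.2 = y.2 ->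
  lam r x y = Lab1 _ (lam1 (proj1_chain r) x.1 y.1).
Hypothesis lam_step2 : forall r x y, good k x -> good k y ->
  x.1 = y.1 -> covers [set: P2] x.2 y.2 ->
  lam r x y = Lab2 _ (lam2 (proj2_chain r) x.2 y.2).
Hypothesis lam_step12 : forall r x y, good k x -> good k y -> wedge k x y ->
  covers [set: P1] x.1 y.1 -> covers [set: P2] x.2 y.2 ->
  lam r x y = Word (lam1 (proj1_chain r) x.1 y.1) (lam2 (proj2_chain r) x.2 y.2).

Lemma CLced_pp : CLced Q prod_sig R le lam.
Proof.
have in1 (a : P1) : a \in [set: P1] by exact: finset.in_setT.
have in2 (a : P2) : a \in [set: P2] by exact: finset.in_setT.
have [gQ rQ] := graded_pp (in1 _) (in1 _) (in2 _) (in2 _) nd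
  (CLced_graded ced1) (CLced_graded ced2).
split.
- split; [exists ((\bot, \bot)%O : T)|exists ((\top, \top)%O : T)].
  + exact: bot_in_pp.
  + by move=> z _; exact: bot_le.
  + exact: top_in_pp.
  + by move=> z _; exact: le_top.
- exact: gQ.
- exact: (CL_product nd wo (CLced_labeling ced1) (CLced_labeling ced2)
    special1 special2 lam_step1 lam_step2 lam_step12).
- move=> s; apply/fintype.subsetP => z; rewrite !in_pp !finset.in_setT.
  by case/and3P.
- move=> s; have [b1 t1] := CLced_ends s.1 ced1; have [b2 t2] := CLced_ends s.2 ced2.
  have [g1 r1] := CLced_rank ced1 s.1; have [g2 r2] := CLced_rank ced2 s.2.
  have [g r] := graded_pp b1 t1 b2 t2 nd g1 g2.
  by split; rewrite // r rQ r1 r2.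
- move=> s; have [b1 t1] := CLced_ends s.1 ced1; have [b2 t2] := CLced_ends s.2 ced2.
  have [e1 [n1 [v1 [J1 H1]]]] := idx_lattice_of_faces (CLced_polytope ced1 s.1).
  have [e2 [n2 [v2 [J2 H2]]]] := idx_lattice_of_faces (CLced_polytope ced2 s.2).
  rewrite /prod_sig; move: nd; case: (k) => /= nd'.
  + exact: polytope_join H1 H2.
  + exact: polytope_product H1 H2 b1 b2.
  + have [w1 [c1 K1]] := idx_lattice_centered H1.
    have [w2 [c2 K2]] := idx_lattice_centered H2.
    case/andP: nd' => nd1 nd2.
    exact: (polytope_direct_sum K1 K2 b1 t1 b2 t2 nd1 nd2 c1 c2).
- move=> s x y r c c' xQ yQ xy mr mc dc /delta_face_proj[f1 f2] mc' dc' /delta_face_proj[f1' f2'].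
  have [gx gy] : good k x /\ good k y.
    by move: xQ yQ; rewrite !in_pp => /and3P[_ _ ->] /and3P[].
  have r1 := rooted_proj1 nd gx mr; have r2 := rooted_proj2 nd gx mr.
  have [xy1 xy2] : (x.1 <= y.1)%O /\ (x.2 <= y.2)%O by apply/andP; rewrite -leEprod.
  apply: (descending_chain_unique nd wo special1 special2 lam_step1 lam_step2
    lam_step12 xQ yQ xy mr mc dc mc' dc').
  + move=> c1 c1' m1 D1 m1' D1' E1 E1'; rewrite -E1 in f1; rewrite -E1' in f1'.
    exact: (CLced_desc ced1 (in1 _) (in1 _) xy1 r1 m1 D1 f1 m1' D1' f1').
  + move=> c2 c2' m2 D2 m2' D2' E2 E2'; rewrite -E2 in f2; rewrite -E2' in f2'.
    exact: (CLced_desc ced2 (in2 _) (in2 _) xy2 r2 m2 D2 f2 m2' D2' f2').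
- move=> s r c rs cc _ fs fr.
  have [f1 f2] := delta_face_proj fs; have [f1' f2'] := delta_face_proj fr.
  have [b1 t1] := CLced_ends s.1 ced1; have [b2 t2] := CLced_ends s.2 ced2.
  have [m nm cm] := fs; have /andP[mm _] := nm.
  have /andP[/andP[m1 _] /andP[m2 _]] : new_chain Sig1 s.1 (proj1_chain m) &&
    new_chain Sig2 s.2 (proj2_chain m) by rewrite -new_chain_proj.
  have csub (M1 : {set P1}) (M2 : {set P2}) : proj1_chain c \subset M1 -> proj2_chain c \subset M2 ->
      c \subset pp k M1 M2.
    move=> /fintype.subsetP s1 /fintype.subsetP s2; apply/fintype.subsetP => z zc.
    have /fintype.subsetP := maxchain_prod_sig_sub mm.
    move/(_ z (fintype.subsetP cm z zc)); rewrite !in_pp => /and3P[_ _ ->].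
    by rewrite s1 ?s2 //; apply/imsetP; exists z.
  move: rs; rewrite ltEprodlexi => /andP[+ /implyP lt2]; rewrite le_eqVlt.
  case/predU1P => [e|lt1].
  (* One projection of [m] is kept and the other replaced by a chain that is not new. Any extension
     of [c] with these projections is not new. *)
  + have {}lt2 : (r.2 < s.2)%O by apply: lt2; rewrite e.
    have [M [MM nM cM]] := boundary_extension ced2 lt2 (chain_proj2 cc) f2 f2'.
    have [N [NN cN E1 E2]] := extend_chain b1 t1 b2 t2 nd m1 MM cc
      (csub _ _ (imsetS _ cm) cM).
    by exists N; split=> //; rewrite new_chain_proj // E2 (negbTE nM) andbF.
  + have [M [MM nM cM]] := boundary_extension ced1 lt1 (chain_proj1 cc) f1 f1'.
    have [N [NN cN E1 E2]] := extend_chain b1 t1 b2 t2 nd MM m2 cc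
      (csub _ _ cM (imsetS _ cm)).
    by exists N; split=> //; rewrite new_chain_proj // E1 (negbTE nM).
- move=> c cc cQ; have [s1 c1] := CLced_union ced1 (chain_proj1 cc) (finset.subsetT _).
  have [s2 c2] := CLced_union ced2 (chain_proj2 cc) (finset.subsetT _).
  by exists ((s1, s2) : I1 *l I2); rewrite sub_prod_sig //= c1.
Qed.

End ProductDecomposition.

(** * Transport along an order embedding of labels *)

Section Relabeling.
Context {d dI : Order.disp_t} {T : finPOrderType d} {I : finOrderType dI}.
Variables (L L' : Type) (g : L -> L') (le : rel L) (le' : rel L') (lam : labeling T L).
Hypothesis g_mono : forall a b, le' (g a) (g b) = le a b.

Definition relabel : labeling T L' := fun r x y => g (lam r x y).

Lemma label_word_relabel r s : label_word relabel r s = map g (label_word lam r s).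
Proof. by elim: s r => // x [|y s] IH r //; rewrite !label_word_cons IH. Qed.

Lemma lexle_map s t : lexle le' (map g s) (map g t) = lexle le s t.
Proof. by elim: s t => [|a s IH] [|b t] //=; rewrite !g_mono IH. Qed.

Lemma increasing_relabel r c : increasing le' (labels relabel r c) = increasing le (labels lam r c).
Proof. by rewrite /increasing /labels label_word_relabel sorted_map; apply: eq_sorted. Qed.

Lemma descending_relabel r c : descending le' (labels relabel r c) = descending le (labels lam r c).
Proof.
rewrite /descending /labels label_word_relabel sorted_map.
by apply: eq_sorted => a b /=; rewrite g_mono.
Qed.

(** Used to bring the plain product back from [wlabel] to the disjoint union of the label sets. *)
Lemma CLced_relabel (Q : {set T}) (Sig : I -> {set T}) (R : realType) :
  partial_order le -> CLced Q Sig R le' relabel -> CLced Q Sig R le lam.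
Proof.
move=> ple [bQ gQ [_ CL] sub rank poly desc bdry union]; split=> //.
- split=> // x y r xQ yQ xy mr; have [c [mc ic uc]] := CL x y r xQ yQ xy mr.
  exists c; split=> //; first by rewrite -increasing_relabel.
  move=> c' /uc; rewrite increasing_relabel /labels !label_word_relabel.
  by rewrite lexle_map.
- move=> s x y r c c' xQ yQ xy mr mc dc fc mc' dc' fc'.
  apply: desc xQ yQ xy mr mc _ fc mc' _ fc'; by rewrite descending_relabel.
Qed.

End Relabeling.

(** * The concrete label orders satisfy the interface *)

Section WordOrders.
Context {L1 L2 : Type} (le1 : rel L1) (le2 : rel L2).
Notation W := (wlabel L1 L2).

Definition word_le (a1 b1 : L1) (a2 b2 : L2) : bool := le1 a1 b1 && (le1 b1 a1 ==> le2 a2 b2).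

Lemma word_le_refl a1 a2 : partial_order le1 -> partial_order le2 -> word_le a1 a1 a2 a2.
Proof. by move=> [r1 _ _] [r2 _ _]; rewrite /word_le r1 r2. Qed.

Lemma word_le_anti a1 b1 a2 b2 : partial_order le1 -> partial_order le2 ->
  word_le a1 b1 a2 b2 -> word_le b1 a1 b2 a2 -> a1 = b1 /\ a2 = b2.
Proof.
move=> [_ n1 _] [_ n2 _] /andP[h1 /implyP h2] /andP[h3 /implyP h4].
by split; [apply: n1; rewrite h1 h3|apply: n2; rewrite h2 // h4].
Qed.

Lemma word_le_trans a1 b1 c1 a2 b2 c2 : partial_order le1 -> partial_order le2 ->
  word_le a1 b1 a2 b2 -> word_le b1 c1 b2 c2 -> word_le a1 c1 a2 c2.
Proof.
move=> [_ _ t1] [_ _ t2] /andP[h1 /implyP h2] /andP[h3 /implyP h4].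
rewrite /word_le (t1 _ _ _ h1 h3) /=; apply/implyP => h5.
exact: t2 (h2 (t1 _ _ _ h3 h5)) (h4 (t1 _ _ _ h5 h1)).
Qed.

(* A shuffle for x, with never-used words put on top. *)
Definition shuffle_words (le : rel (L1 + L2)) : rel W := fun u v =>
  match u, v with
  | Lab1 a, Lab1 b => le (inl a) (inl b)
  | Lab1 a, Lab2 b => le (inl a) (inr b)
  | Lab2 a, Lab1 b => le (inr a) (inl b)
  | Lab2 a, Lab2 b => le (inr a) (inr b)
  | Word a1 a2, Word b1 b2 => word_le a1 b1 a2 b2
  | Word _ _, _ => false
  | _, Word _ _ => true
  end.

(** With [pred0] in place of S^A, the clauses comparing a word with a letter are vacuous. *)
Lemma shuffle_word_order le : partial_order le1 -> partial_order le2 ->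
  shuffle le1 le2 le -> word_order pred0 pred0 le1 le2 (shuffle_words le).
Proof.
move=> p1 p2 [[rf an tr] h1 h2 h12]; split=> //.
- split.
  + by move=> [a|a|a b] /=; rewrite ?rf // word_le_refl.
  + move=> [a|a|a b] [c|c|c e] //= /andP[].
    * by move=> x y; have := an (inl a) (inl c); rewrite x y => /(_ isT)[->].
    * by move=> x y; have := an (inl a) (inr c); rewrite x y => /(_ isT).
    * by move=> x y; have := an (inr a) (inl c); rewrite x y => /(_ isT).
    * by move=> x y; have := an (inr a) (inr c); rewrite x y => /(_ isT)[->].
    * by move=> x y; have [-> ->] := word_le_anti p1 p2 x y.
  + move=> [a|a|a b] [c|c|c e] [f|f|f g] //=; try exact: tr.
    exact: word_le_trans.
- move=> [a|a|a b] [c|c|c e] //= _.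
  by rewrite orbC; exact: h12.
Qed.

Variables (sg1 : L1 -> part) (sg2 : L2 -> part).

Definition is_mid (p : part) : bool := if p is SMid then true else false.

Lemma is_midP p : is_mid p <-> p = SMid.
Proof. by case: p. Qed.

Lemma word_shuffle_order : split_total_order le1 sg1 -> split_total_order le2 sg2 ->
  word_order (is_mid \o sg1) (is_mid \o sg2) le1 le2 (word_shuffle le1 le2 sg1 sg2).
Proof.
move=> [p1 tot1 s1] [p2 tot2 s2].
pose blk := @wblock L1 L2 sg1 sg2.
pose same (u v : W) := match u, v with
  | Lab1 a, Lab1 b => le1 a b
  | Lab2 a, Lab2 b => le2 a b
  | Word a1 a2, Word b1 b2 => word_le a1 b1 a2 b2
  | _, _ => false end.
(* As a lexicographic order, by block first and then inside the block, the order laws reduce to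
   those of [same]. *)
have wsE u v : word_shuffle le1 le2 sg1 sg2 u v = (blk u < blk v) || (blk u == blk v) && same u v.
  by case: u v => [a|a|a b] [c|c|c e]; rewrite /word_shuffle /= ?andbF.
have [r1 n1 t1] := p1; have [r2 n2 t2] := p2.
(* By antisymmetry the splitting is strict, so the order of blocks agrees with [le1] across
   different parts. *)
have sg1F a b : part_rank (sg1 a) < part_rank (sg1 b) -> le1 b a = false.
  move=> lt; apply/negP => h; have e : a = b by apply: n1; rewrite h s1.
  by rewrite e ltnn in lt.
have sg2F a b : part_rank (sg2 a) < part_rank (sg2 b) -> le2 b a = false.
  move=> lt; apply/negP => h; have e : a = b by apply: n2; rewrite h s2.
  by rewrite e ltnn in lt.
split.
- split.
  + move=> u; rewrite wsE eqxx /=.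
    by case: u => [a|a|a b] /=; rewrite ?r1 ?r2 ?word_le_refl ?orbT.
  + move=> u v; rewrite !wsE eq_sym => /andP[].
    case: ltngtP => //= _.
    case: u v => [a|a|a b] [c|c|c e] //= x y.
    * by congr Lab1; apply: n1; rewrite x y.
    * by congr Lab2; apply: n2; rewrite x y.
    * by have [-> ->] := word_le_anti p1 p2 x y.
  + move=> v u t; rewrite !wsE.
    case: (ltngtP (blk u) (blk v)) => //= [uv|<-].
      move=> _; case: (ltngtP (blk v) (blk t)) => //= [vt|<-] _.
      * by rewrite (ltn_trans uv vt).
      * by rewrite uv.
    move=> suv; case: (ltngtP (blk u) (blk t)) => //= _.
    case: u v t suv => [a|a|a b] [c|c|c e] [f|f|f g] //=.
    * exact: t1.
    * exact: t2.
    * exact: word_le_trans.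
- move=> u v; rewrite !wsE [in X in _ || X]eq_sym.
  case: u v => [a|a|a b] [c|c|c e] //= _.
  * by case: (sg1 a); case: (sg2 c).
  * by case: (sg1 a).
  * by case: (sg2 a); case: (sg1 c).
  * by case: (sg2 a).
  * by case: (sg1 c).
  * by case: (sg2 c).
- move=> a b; rewrite wsE /=; case ea: (sg1 a); case eb: (sg1 b) => //=;
  first [by rewrite s1 ?ea ?eb | by rewrite sg1F ?ea ?eb].
- move=> a b; rewrite wsE /=; case ea: (sg2 a); case eb: (sg2 b) => //=;
  first [by rewrite s2 ?ea ?eb | by rewrite sg2F ?ea ?eb].
- by move=> a b a' b'; rewrite wsE.
(* The word block lies above both S^- blocks and below both S^+ blocks, just as a letter of S^A
   does. *)
- move=> a b c /= /is_midP ea nc; rewrite wsE /= ; case ec: (sg1 c) nc => //= _;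
  first [by rewrite s1 ?ea ?ec | by rewrite sg1F ?ea ?ec].
- move=> a b c /= /is_midP ea nc; rewrite wsE /= ; case ec: (sg1 c) nc => //= _;
  first [by rewrite s1 ?ea ?ec | by rewrite sg1F ?ea ?ec].
- move=> a b c /= /is_midP ea nc; rewrite wsE /= ; case ec: (sg2 c) nc => //= _;
  first [by rewrite s2 ?ea ?ec | by rewrite sg2F ?ea ?ec].
- move=> a b c /= /is_midP ea nc; rewrite wsE /= ; case ec: (sg2 c) nc => //= _;
  first [by rewrite s2 ?ea ?ec | by rewrite sg2F ?ea ?ec].
Qed.

End WordOrders.

(** * Matching the given products and labelings with the uniform family *)

Section ProductSets.
Context {d1 d2 : Order.disp_t} {T1 : finTBPOrderType d1} {T2 : finTBPOrderType d2}.
Notation T := (T1 *p T2).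

Lemma prod_posetE (A1 : {set T1}) (A2 : {set T2}) : prod_poset A1 A2 = pp PX A1 A2.
Proof. by apply/finset.setP => z; rewrite !inE andbT. Qed.

Lemma pair_eqE (z : T) (a : T1) (b : T2) : (z == ((a, b) : T)) = (z.1 == a) && (z.2 == b).
Proof.
apply/eqP/andP => [->|[/eqP e1 /eqP e2]]; first by rewrite !eqxx.
by apply: prod_eqP.
Qed.

Lemma check_posetE (A1 : {set T1}) (A2 : {set T2}) : \bot%O \in A1 -> \bot%O \in A2 ->
  check_poset A1 A2 = pp PC A1 A2.
Proof.
move=> b1 b2; apply/finset.setP => z; rewrite !inE pair_eqE /=.
have [->|n1] := eqVneq z.1 \bot%O; have [->|n2] := eqVneq z.2 \bot%O;
by rewrite ?b1 ?b2 ?andbF ?andbT /=.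
Qed.

Lemma hat_posetE (A1 : {set T1}) (A2 : {set T2}) : \top%O \in A1 -> \top%O \in A2 ->
  hat_poset A1 A2 = pp PH A1 A2.
Proof.
move=> b1 b2; apply/finset.setP => z; rewrite !inE pair_eqE /=.
have [->|n1] := eqVneq z.1 \top%O; have [->|n2] := eqVneq z.2 \top%O;
by rewrite ?b1 ?b2 ?andbF ?andbT /=.
Qed.

Lemma trivial_top {d} {P : finTBPOrderType d} (x : P) :
  (\bot%O : P) = \top%O -> x = \top%O.
Proof. by move=> e; apply: le_anti; rewrite lex1 -e le0x. Qed.

(** In a one-point factor the coordinate is always the bottom, and goodness drags the other
    coordinate down with it. *)
Lemma check_trivial (A1 : {set T1}) (A2 : {set T2}) : \bot%O \in A1 -> \bot%O \in A2 ->
  ~~ nontrivial_factors (T1 := T1) (T2 := T2) PC ->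
  pp PC A1 A2 = [set ((\bot, \bot)%O : T)].
Proof.
move=> b1 b2 nt; apply/finset.setP => z; rewrite in_pp finset.in_set1 pair_eqE /=.
have [->|n1] := eqVneq z.1 \bot%O; have [->|n2] := eqVneq z.2 \bot%O;
  rewrite ?b1 ?b2 ?andbF //=.
move: nt; rewrite negb_and !negbK => /orP[]/eqP e.
- by rewrite [z.1](trivial_top _ e) e eqxx in n1.
- by rewrite [z.2](trivial_top _ e) e eqxx in n2.
Qed.

Lemma hat_trivial (A1 : {set T1}) (A2 : {set T2}) : \top%O \in A1 -> \top%O \in A2 ->
  ~~ nontrivial_factors (T1 := T1) (T2 := T2) PH ->
  pp PH A1 A2 = [set ((\top, \top)%O : T)].
Proof.
move=> b1 b2 nt; apply/finset.setP => z; rewrite in_pp finset.in_set1 pair_eqE /=.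
have [->|n1] := eqVneq z.1 \top%O; have [->|n2] := eqVneq z.2 \top%O;
  rewrite ?b1 ?b2 ?andbF //=.
move: nt; rewrite negb_and !negbK => /orP[]/eqP e.
- by rewrite [z.1](trivial_top _ e) eqxx in n1.
- by rewrite [z.2](trivial_top _ e) eqxx in n2.
Qed.

(** The empty chain must lie in some member, so there is one. *)
Lemma CLced_index {dI : Order.disp_t} {I : finOrderType dI} (Sig : I -> {set T1})
    (R : realType) L (le : rel L) lam Q :
  CLced Q Sig R le lam -> exists i : I, true.
Proof.
move=> ced; have [||i _] := CLced_union ced (c := finset.set0); last by exists i.
- by apply/chainP => x y; rewrite inE.
- exact: finset.sub0set.
Qed.

Context {L1 L2 : Type} (lam1 : labeling T1 L1) (lam2 : labeling T2 L2).
Implicit Types (x y : T) (r : {set T}).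

Lemma covers_irr {d} {P : finPOrderType d} (A : {set P}) (x : P) : covers A x x = false.
Proof. by apply/negP => /covers_lt; rewrite ltxx. Qed.

Lemma check_step1 r x y : good PC x -> good PC y -> covers [set: T1] x.1 y.1 -> x.2 = y.2 ->
  check_labeling lam1 lam2 r x y = Lab1 _ (lam1 (proj1_chain r) x.1 y.1).
Proof.
move=> gx gy c e; have /= nb := step1_good gx gy (covers_lt c) e.
by rewrite /check_labeling /word_labeling pair_eqE (negbTE nb) /prod_labeling /= c.
Qed.

Lemma check_step2 r x y : good PC x -> good PC y -> x.1 = y.1 -> covers [set: T2] x.2 y.2 ->
  check_labeling lam1 lam2 r x y = Lab2 _ (lam2 (proj2_chain r) x.2 y.2).
Proof.
move=> gx gy e c; have /= nb := step2_good gx gy e (covers_lt c).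
rewrite /check_labeling /word_labeling pair_eqE (negbTE nb) /prod_labeling /=.
by rewrite e covers_irr.
Qed.

Lemma check_step12 r x y : good PC x -> good PC y -> wedge PC x y ->
  check_labeling lam1 lam2 r x y =
  Word (lam1 (proj1_chain r) x.1 y.1) (lam2 (proj2_chain r) x.2 y.2).
Proof.
move=> gx gy w; have /= e := wedge_bot_top gx gy w.
by rewrite /check_labeling /word_labeling e eqxx.
Qed.

Lemma hat_step1 r x y : good PH x -> good PH y -> covers [set: T1] x.1 y.1 -> x.2 = y.2 ->
  hat_labeling lam1 lam2 r x y = Lab1 _ (lam1 (proj1_chain r) x.1 y.1).
Proof.
move=> gx gy c e; have /= nb := step1_good gx gy (covers_lt c) e.
by rewrite /hat_labeling /word_labeling pair_eqE (negbTE nb) /prod_labeling /= c.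
Qed.

Lemma hat_step2 r x y : good PH x -> good PH y -> x.1 = y.1 -> covers [set: T2] x.2 y.2 ->
  hat_labeling lam1 lam2 r x y = Lab2 _ (lam2 (proj2_chain r) x.2 y.2).
Proof.
move=> gx gy e c; have /= nb := step2_good gx gy e (covers_lt c).
rewrite /hat_labeling /word_labeling pair_eqE (negbTE nb) /prod_labeling /=.
by rewrite e covers_irr.
Qed.

Lemma hat_step12 r x y : good PH x -> good PH y -> wedge PH x y ->
  hat_labeling lam1 lam2 r x y =
  Word (lam1 (proj1_chain r) x.1 y.1) (lam2 (proj2_chain r) x.2 y.2).
Proof.
move=> gx gy w; have /= e := wedge_bot_top gx gy w.
by rewrite /hat_labeling /word_labeling e eqxx.
Qed.

Lemma prod_step1 r x y : good PX x -> good PX y -> covers [set: T1] x.1 y.1 -> x.2 = y.2 ->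
  relabel (@letter L1 L2) (prod_labeling lam1 lam2) r x y =
  Lab1 _ (lam1 (proj1_chain r) x.1 y.1).
Proof. by move=> _ _ c _; rewrite /relabel /prod_labeling c. Qed.

Lemma prod_step2 r x y : good PX x -> good PX y -> x.1 = y.1 -> covers [set: T2] x.2 y.2 ->
  relabel (@letter L1 L2) (prod_labeling lam1 lam2) r x y =
  Lab2 _ (lam2 (proj2_chain r) x.2 y.2).
Proof. by move=> _ _ e _; rewrite /relabel /prod_labeling e covers_irr. Qed.

End ProductSets.

(** * Orderliness as a condition on special edges *)

Section OrderlySpecial.
Context {d : Order.disp_t} {P : finTBPOrderType d} {L : Type}.
Variables (le : rel L) (sg : L -> part) (lam : labeling P L).

Lemma orderly_special : orderly le sg lam -> forall r x y,
  covers [set: P] x y -> maxchain (below [set: P] x) r ->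
  (is_mid \o sg) (lam r x y) = special PC x y.
Proof.
move=> [_ H] r x y xy mr; apply/idP/eqP => [/is_midP|] /=.
  by move/(H r x y xy mr).
by move/(H r x y xy mr)=> ->.
Qed.

Lemma co_orderly_special : co_orderly le sg lam -> forall r x y,
  covers [set: P] x y -> maxchain (below [set: P] x) r ->
  (is_mid \o sg) (lam r x y) = special PH x y.
Proof.
move=> [_ H] r x y xy mr; apply/idP/eqP => [/is_midP|] /=.
  by move/(H r x y xy mr).
by move/(H r x y xy mr)=> ->.
Qed.

End OrderlySpecial.

Theorem theorem5p13 (R : realType)
  (d1 d2 dI1 dI2 : Order.disp_t)
  (P1 : finTBPOrderType d1) (P2 : finTBPOrderType d2)
  (I1 : finOrderType dI1) (I2 : finOrderType dI2)
  (L1 L2 : Type) (le1 : rel L1) (le2 : rel L2)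
  (lam1 : labeling P1 L1) (lam2 : labeling P2 L2)
  (Sig1 : I1 -> {set P1}) (Sig2 : I2 -> {set P2})
  (ced1 : CLced [set: P1] Sig1 R le1 lam1)
  (ced2 : CLced [set: P2] Sig2 R le2 lam2) :
  [/\ forall le : rel (L1 + L2), shuffle le1 le2 le ->
        CLced (prod_poset [set: P1] [set: P2])
          (fun st : I1 *l I2 => prod_poset (Sig1 st.1) (Sig2 st.2))
          R le (prod_labeling lam1 lam2),
      forall (sg1 : L1 -> part) (sg2 : L2 -> part),
        orderly le1 sg1 lam1 -> orderly le2 sg2 lam2 ->
        CLced (check_poset [set: P1] [set: P2])
          (fun st : I1 *l I2 => check_poset (Sig1 st.1) (Sig2 st.2))
          R (word_shuffle le1 le2 sg1 sg2) (check_labeling lam1 lam2) &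
      forall (sg1 : L1 -> part) (sg2 : L2 -> part),
        co_orderly le1 sg1 lam1 -> co_orderly le2 sg2 lam2 ->
        CLced (hat_poset [set: P1] [set: P2])
          (fun st : I1 *l I2 => hat_poset (Sig1 st.1) (Sig2 st.2))
          R (word_shuffle le1 le2 sg1 sg2) (hat_labeling lam1 lam2)].
Proof.
have [p1 _] := CLced_labeling ced1; have [p2 _] := CLced_labeling ced2.
have index : exists st : I1 *l I2, true.
  by have [i1 _] := CLced_index ced1; have [i2 _] := CLced_index ced2; exists (i1, i2).
have ends1 s := CLced_ends s ced1; have ends2 s := CLced_ends s ced2.
have in1 (a : P1) : a \in [set: P1] by exact: finset.in_setT.
have in2 (a : P2) : a \in [set: P2] by exact: finset.in_setT.
split.
- move=> le sh.
  have -> : (fun st : I1 *l I2 => prod_poset (Sig1 st.1) (Sig2 st.2)) = prod_sig Sig1 Sig2 PX.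
    by apply: funext => st; rewrite prod_posetE.
  rewrite prod_posetE.
  have [ple le11 le22 _] := sh.
  apply: (@CLced_relabel _ _ _ _ _ _ (@letter L1 L2) le (shuffle_words le1 le2 le)) => //.
    by move=> [a|a] [b|b].
  apply: (CLced_pp ced1 ced2 _ (shuffle_word_order p1 p2 sh)) => //.
  + exact: prod_step1.
  + exact: prod_step2.
- move=> sg1 sg2 o1 o2; have wo := word_shuffle_order o1.1 o2.1.
  have E st : check_poset (Sig1 st.1) (Sig2 st.2) = prod_sig Sig1 Sig2 PC st.
    by rewrite check_posetE //; [case: (ends1 st.1)|case: (ends2 st.2)].
  rewrite (funext E) check_posetE //.
  (* With a one-point factor the product and all the members of the decomposition are the single
     pair of bottoms. *)
  have [nd|nd] := boolP (nontrivial_factors (T1 := P1) (T2 := P2) PC).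
    apply: (CLced_pp ced1 ced2 nd wo).
    + exact: orderly_special o1.
    + exact: orderly_special o2.
    + exact: check_step1.
    + exact: check_step2.
    + by move=> r x y gx gy w _ _; exact: check_step12.
  rewrite check_trivial //; apply: CLced_singleton => //; first exact: wo_order wo.
  by move=> s; apply: check_trivial => //; [case: (ends1 s.1)|case: (ends2 s.2)].
- move=> sg1 sg2 o1 o2; have wo := word_shuffle_order o1.1 o2.1.
  have E st : hat_poset (Sig1 st.1) (Sig2 st.2) = prod_sig Sig1 Sig2 PH st.
    by rewrite hat_posetE //; [case: (ends1 st.1)|case: (ends2 st.2)].
  rewrite (funext E) hat_posetE //.
  have [nd|nd] := boolP (nontrivial_factors (T1 := P1) (T2 := P2) PH).
    apply: (CLced_pp ced1 ced2 nd wo).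
    + exact: co_orderly_special o1.
    + exact: co_orderly_special o2.
    + exact: hat_step1.
    + exact: hat_step2.
    + by move=> r x y gx gy w _ _; exact: hat_step12.
  rewrite hat_trivial //; apply: CLced_singleton => //; first exact: wo_order wo.
  by move=> s; apply: hat_trivial => //; [case: (ends1 s.1)|case: (ends2 s.2)].
Qed.
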